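(* Let $\mathbb{F}_q$ be a finite field of characteristic $p$ and let $n$ be a positive integer with $p>n$. Let $\lambda$ be a partition of $n$ with conjugate partition $\lambda'$, and let $T_1,\ldots,T_{d_\lambda}$ be the standard Young tableaux of shape $\lambda$, with conjugate (transposed) tableaux $T_1',\ldots,T_{d_\lambda}'$, which are the standard tableaux of shape $\lambda'$. Suppose the tableaux are ordered by an order (written $<$, $>$) that satisfies the property $$i>j \iff T_i>T_j \iff T_i'<T_j' \iff e_{T_i}e_{T_j}=0 \text{ and } \overline{e}_{T_i'}\overline{e}_{T_j'}=0.$$ Then the centrally primitive idempotents $e_\lambda^{S_n}$ and $e_{\lambda'}^{S_n}$ of $\mathbb{F}_qS_n$ associated to $\lambda$ and $\lambda'$, respectively, are given by $$e_\lambda^{S_n}=1-\prod_{i=1}^{d_\lambda}(1-e_{T_i})\qquad\text{and}\qquad e_{\lambda'}^{S_n}=1-\prod_{i=1}^{d_\lambda}(1-\overline{e}_{T_i'}),$$ where the products are taken in increasing order of $i$ from left to right.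
   Context: $S_n$ is the symmetric group; since $p>n$, $\mathbb{F}_qS_n$ is semisimple. A Young tableau $T$ of shape $\mu$ (a partition of $n$) is a filling of the Young diagram of $\mu$ with the distinct numbers $1,\ldots,n$; it is standard if entries increase along each row and down each column. $d_\mu$ is the number of standard Young tableaux of shape $\mu$; $d_\mu=d_{\mu'}$, where $\mu'$ is the conjugate partition (transposed diagram). For a tableau $T$ let $R_T$ (row stabilizer) and $C_T$ (column stabilizer) be the subgroups of $S_n$ of permutations preserving each row, respectively each column, of $T$ as a set. If $T$ has shape $\mu$, define in $\mathbb{F}_qS_n$ $$e_T=\frac{d_\mu}{n!}\sum_{\rho\in R_T}\sum_{\sigma\in C_T}\operatorname{sgn}(\sigma)\,\sigma\rho,\qquad \overline{e}_T=\frac{d_\mu}{n!}\sum_{\rho\in R_T}\sum_{\sigma\in C_T}\operatorname{sgn}(\sigma)\,\rho\sigma;$$ these are primitive idempotents of $\mathbb{F}_qS_n$. The Wedderburn–Artin decomposition is $\mathbb{F}_qS_n=\bigoplus_{\mu}J_\mu$ over partitions $\mu$ of $n$, where $J_\mu\cong M_{d_\mu}(\mathbb{F}_q)$ is the two-sided ideal corresponding to $\mu$, i.e. the minimal two-sided ideal containing $e_T$ for the tableaux $T$ of shape $\mu$. The centrally primitive idempotent associated to $\mu$, denoted $e_\mu^{S_n}$, is the centrally primitive idempotent generating $J_\mu$, so that $J_\mu=\mathbb{F}_qS_ne_\mu^{S_n}$. *)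

(* Defs.v *)
From HB Require Import structures.
From mathcomp Require Import all_boot all_order all_algebra all_fingroup.

Set Implicit Arguments.
Unset Strict Implicit.
Unset Printing Implicit Defensive.

Import GRing.Theory.
Local Open Scope ring_scope.

(* The type {ffun gT -> F} already carries the pointwise product; the group   *)
(* algebra is therefore a separate alias, with the convolution product.       *)
Definition group_algebra (F : finFieldType) (gT : finGroupType) : Type :=
  {ffun gT -> F^o}.

Section GroupAlgebra.
Variables (F : finFieldType) (gT : finGroupType).
Notation A := (group_algebra F gT).

HB.instance Definition _ := Finite.copy A {ffun gT -> F^o}.
HB.instance Definition _ := GRing.Lmodule.copy A {ffun gT -> F^o}.

Definition ga_coef (a : A) : gT -> F := fun_of_fin a.

Definition ga_delta (g : gT) : A := [ffun x => (x == g)%:R].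

Definition ga_mul (a b : A) : A :=
  [ffun x => \sum_y ga_coef a y * ga_coef b (y^-1 * x)%g].

Lemma ga_mulA : associative ga_mul.
Proof.
move=> a b c; apply/ffunP=> x; rewrite !ffunE /ga_coef.
under eq_bigr do rewrite ffunE big_distrr /=.
under [RHS]eq_bigr do rewrite ffunE big_distrl /=.
rewrite [RHS]exchange_big; apply: eq_bigr => y _ /=.
rewrite (reindex_inj (mulgI y^-1%g)) /=; apply: eq_bigr => z _.
by rewrite /ga_coef mulrA invMg invgK -!mulgA mulVKg.
Qed.

Lemma ga_mul1 : left_id (ga_delta 1%g) ga_mul.
Proof.
move=> a; apply/ffunP=> x; rewrite ffunE /ga_coef (bigD1 1%g) //= ffunE eqxx.
rewrite mul1r invg1 mul1g big1 ?addr0 // => y ny.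
by rewrite ffunE (negPf ny) mul0r.
Qed.

Lemma ga_mulr1 : right_id (ga_delta 1%g) ga_mul.
Proof.
move=> a; apply/ffunP=> x; rewrite ffunE /ga_coef (bigD1 x) //= ffunE mulVg.
rewrite eqxx mulr1 big1 ?addr0 // => y ny.
by rewrite ffunE -eq_mulVg1 (negPf ny) mulr0.
Qed.

Lemma ga_mulDl : left_distributive ga_mul +%R.
Proof.
move=> a b c; apply/ffunP=> x; rewrite !ffunE -big_split; apply: eq_bigr => y _.
by rewrite /ga_coef ffunE mulrDl.
Qed.

Lemma ga_mulDr : right_distributive ga_mul +%R.
Proof.
move=> a b c; apply/ffunP=> x; rewrite !ffunE -big_split; apply: eq_bigr => y _.
by rewrite /ga_coef ffunE mulrDr.
Qed.

Lemma ga_one_neq0 : ga_delta 1%g != 0.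
Proof.
apply/eqP=> /ffunP/(_ 1%g); rewrite !ffunE eqxx.
by apply/eqP; rewrite oner_eq0.
Qed.

HB.instance Definition _ := GRing.Zmodule_isNzRing.Build A
  ga_mulA ga_mul1 ga_mulr1 ga_mulDl ga_mulDr ga_one_neq0.

Lemma ga_scalerAl (k : F) (a b : A) : k *: (a * b) = (k *: a) * b.
Proof.
apply/ffunP=> x; rewrite !ffunE scaler_sumr; apply: eq_bigr => y _.
by rewrite /ga_coef ffunE -mulrA.
Qed.

HB.instance Definition _ := GRing.Lmodule_isLalgebra.Build F A ga_scalerAl.

Lemma ga_scalerAr (k : F) (a b : A) : k *: (a * b) = a * (k *: b).
Proof.
apply/ffunP=> x; rewrite !ffunE scaler_sumr; apply: eq_bigr => y _.
by rewrite /ga_coef ffunE mulrCA.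
Qed.

HB.instance Definition _ := GRing.Lalgebra_isAlgebra.Build F A ga_scalerAr.

End GroupAlgebra.

Section CentralIdempotents.
Variable A : nzRingType.

Definition central_idempotent (e : A) : Prop :=
  e * e = e /\ forall a, a * e = e * a.

Definition centrally_primitive (e : A) : Prop :=
  [/\ central_idempotent e, e <> 0
    & forall e1 e2, central_idempotent e1 -> central_idempotent e2 ->
        e1 * e2 = 0 -> e = e1 + e2 -> e1 = 0 \/ e2 = 0].

Definition two_sided_ideal (J : A -> Prop) : Prop :=
  [/\ J 0, forall a b, J a -> J b -> J (a + b)
    & forall a x b, J x -> J (a * x * b)].

End CentralIdempotents.

Section Partitions.

Definition is_partition (n : nat) (mu : seq nat) : bool :=
  [&& sorted geq mu, 0%N \notin mu & sumn mu == n].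

Definition conj_partition (mu : seq nat) : seq nat :=
  mkseq (fun j => count (fun r => j < r)%N mu) (head 0%N mu).

End Partitions.

Section Tableaux.
Variable n : nat.
Implicit Types (mu : seq nat).

(* All rows and columns of a partition of n have index < n, so the cells of   *)
(* its diagram live in 'I_n * 'I_n (row, column).                             *)
Definition diagram mu : {set 'I_n * 'I_n} :=
  [set c : 'I_n * 'I_n | (c.2 < nth 0%N mu c.1)%N].

(* A filling is stored as the map sending each entry to the cell it occupies; *)
(* the entries 1, ..., n are represented by 0, ..., n-1 in 'I_n.              *)
Definition filling : Type := {ffun 'I_n -> 'I_n * 'I_n}.
HB.instance Definition _ := Finite.on filling.

Implicit Type T : filling.
Definition cell T (k : 'I_n) : 'I_n * 'I_n := fun_of_fin T k.

Definition is_tableau mu T : bool :=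
  injectiveb T && (cell T @: [set: 'I_n] == diagram mu).

Definition is_standard mu T : bool :=
  [&& is_tableau mu T,
      [forall i, forall j, ((cell T i).1 == (cell T j).1) &&
                           ((cell T i).2 < (cell T j).2)%N ==> (i < j)%N]
    & [forall i, forall j, ((cell T i).2 == (cell T j).2) &&
                           ((cell T i).1 < (cell T j).1)%N ==> (i < j)%N]].

Definition std_tableaux mu : {set filling} := [set T | is_standard mu T].

Definition num_std mu : nat := #|std_tableaux mu|.

Definition conj_tableau T : filling := [ffun k => ((cell T k).2, (cell T k).1)].

Definition tab_row T (r : 'I_n) : {set 'I_n} := [set k | (cell T k).1 == r].
Definition tab_col T (c : 'I_n) : {set 'I_n} := [set k | (cell T k).2 == c].

Definition row_stab T : {set 'S_n} :=
  [set s : 'S_n | [forall r, s @: tab_row T r == tab_row T r]].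
Definition col_stab T : {set 'S_n} :=
  [set s : 'S_n | [forall c, s @: tab_col T c == tab_col T c]].

End Tableaux.

Section YoungIdempotents.
Variables (F : finFieldType) (n : nat).
Notation FSn := (group_algebra F 'S_n).

(* Here s * r is the product of perm.v, which composes from left to right.    *)
(* The opposite convention gives an isomorphic situation: g |-> g^-1 is an    *)
(* isomorphism between the two group algebras which, the stabilizers being    *)
(* subgroups, sends each of the elements below to its namesake.               *)
Definition young_idem (mu : seq nat) (T : filling n) : FSn :=
  ((num_std n mu)%:R / (n`!)%:R : F) *:
    \sum_(r in row_stab T) \sum_(s in col_stab T)
      ((-1) ^+ odd_perm s : F) *: ga_delta F (s * r)%g.

Definition young_idem_bar (mu : seq nat) (T : filling n) : FSn :=
  ((num_std n mu)%:R / (n`!)%:R : F) *: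
    \sum_(r in row_stab T) \sum_(s in col_stab T)
      ((-1) ^+ odd_perm s : F) *: ga_delta F (r * s)%g.

(* The smallest two-sided ideal containing e_T for all T of shape mu.         *)
Definition wedderburn_ideal (mu : seq nat) (x : FSn) : Prop :=
  forall J : FSn -> Prop, two_sided_ideal J ->
    (forall T, is_tableau mu T -> J (young_idem mu T)) -> J x.

Definition is_central_idem_of (mu : seq nat) (e : FSn) : Prop :=
  centrally_primitive e /\
  forall x, wedderburn_ideal mu x <-> exists a, x = a * e.

End YoungIdempotents.

(* Main.v *)
(* Let c_T = b_T a_T be the Young symmetrizer of a tableau T (signed column   *)
(* sum times row sum). Von Neumann's lemma gives c_T x c_T in F c_T. Garnir   *)
(* relations express every g c_T through the g c_T for which the tableau of g *)
(* is standard, and these are independent because c_U c_V = 0 for distinct    *)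
(* standard U, V when the row word of U precedes that of V. Comparing the     *)
(* trace n! of right multiplication by c_T with the dimension d of its image  *)
(* yields c_T^2 = (n!/d) c_T, so that e_T is idempotent.                      *)
(*   Put f = 1 - (1 - e_1) ... (1 - e_d). Orthogonality in one direction gives*)
(* f e_i = e_i, and by straightening f is then a left identity of the ideal J *)
(* generated by the e_T; also f lies in J. The anti-automorphism g |-> g^-1   *)
(* preserves J, hence f* is a right identity, f = f* is central, and it is    *)
(* primitive because e_T J e_T = F e_T. The automorphism g |-> sgn(g) g       *)
(* exchanges e_T and the barred idempotent of T', which reduces the           *)
(* conjugate statement to the first one.                                      *)

Require Import Defs.
From HB Require Import structures.
From mathcomp Require Import all_boot all_order all_algebra all_fingroup.
From mathcomp Require Import zify ring.

Set Implicit Arguments.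
Unset Strict Implicit.
Unset Printing Implicit Defensive.

Import GRing.Theory.
Local Open Scope ring_scope.

(** * Group algebras *)

(** Let [c] be the symmetrizer of a tableau and A the group algebra. [young_sym_unique] makes [c]
    quasi-idempotent, and makes central idempotents act on [c] as scalars. [young_sym_straighten]
    and the triangularity from [standard_row_word_le] give the left ideal A c a basis indexed by
    standard tableaux, and [ga_quasi_idem_dim] turns its size d into the scalar n!/d. A left
    identity of the Wedderburn ideal can thus be tested on the standard tableaux alone, where
    [triangular_idem_prod] needs orthogonality in one direction only. Inversion of permutations
    makes this left identity two-sided, hence central ([young_idem_prod_central]); the sign
    automorphism carries it to the conjugate shape ([central_idem_of_twist]). *)

HB.instance Definition _ (F : finFieldType) (gT : finGroupType) :=
  Vector.copy (group_algebra F gT) {ffun gT -> F^o}.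

Lemma span_ind (K : fieldType) (vT : vectType K) (s : seq vT) (P : vT -> Prop) :
    P 0 -> (forall u v, P u -> P v -> P (u + v)) ->
    (forall k u, P u -> P (k *: u)) -> (forall v, v \in s -> P v) ->
  forall v, v \in <<s>>%VS -> P v.
Proof.
move=> P0 PD PZ Ps v v_s; have {}v_s : v \in <<in_tuple s>>%VS by [].
rewrite (coord_span v_s); apply: (big_ind P) => // i _; apply/PZ/Ps.
by rewrite mem_nth.
Qed.

Section GroupAlgebraTheory.
Variables (F : finFieldType) (gT : finGroupType).
Notation A := (group_algebra F gT).
Implicit Types (a b c : A) (g h : gT).

Lemma ga_coefD a b g : ga_coef (a + b) g = ga_coef a g + ga_coef b g.
Proof. by rewrite /ga_coef ffunE. Qed.

Lemma ga_coefZ (k : F) a g : ga_coef (k *: a) g = k * ga_coef a g.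
Proof. by rewrite /ga_coef ffunE. Qed.

Lemma ga_coef_sum (I : Type) (r : seq I) (P : pred I) (f : I -> A) g :
  ga_coef (\sum_(i <- r | P i) f i) g = \sum_(i <- r | P i) ga_coef (f i) g.
Proof.
apply: (big_morph (fun a => ga_coef a g)) => [a b|]; first exact: ga_coefD.
by rewrite /ga_coef ffunE.
Qed.

Lemma ga_coef_delta g h : ga_coef (ga_delta F g) h = (h == g)%:R.
Proof. by rewrite /ga_coef ffunE. Qed.

Lemma ga_coefM a b g :
  ga_coef (a * b) g = \sum_h ga_coef a h * ga_coef b (h^-1 * g)%g.
Proof. by rewrite /ga_coef ffunE. Qed.

Lemma ga_eqP a b : (forall g, ga_coef a g = ga_coef b g) -> a = b.
Proof. by move=> eq_ab; apply/ffunP=> g; exact: eq_ab. Qed.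

Lemma ga_coef_deltal a g h :
  ga_coef (ga_delta F g * a) h = ga_coef a (g^-1 * h)%g.
Proof.
rewrite ga_coefM (bigD1 g) //= ga_coef_delta eqxx mul1r big1 ?addr0 // => x nx.
by rewrite ga_coef_delta (negPf nx) mul0r.
Qed.

Lemma ga_coef_deltar a g h :
  ga_coef (a * ga_delta F g) h = ga_coef a (h * g^-1)%g.
Proof.
rewrite ga_coefM (bigD1 (h * g^-1)%g) //= ga_coef_delta invMg invgK -mulgA.
rewrite mulVg mulg1 eqxx mulr1 big1 ?addr0 // => x nx.
rewrite ga_coef_delta (_ : (_ == _) = false) ?mulr0 //; apply/eqP=> eg.
by case/eqP: nx; rewrite -eg invMg invgK mulKVg.
Qed.

Lemma ga_deltaM g h : ga_delta F (g * h)%g = ga_delta F g * ga_delta F h.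
Proof.
apply: ga_eqP => x; rewrite ga_coef_deltal !ga_coef_delta.
by rewrite -(inj_eq (mulgI g) (g^-1 * x)%g) mulKVg.
Qed.

Lemma ga_delta1 : ga_delta F (1%g : gT) = 1.
Proof. by []. Qed.

Lemma ga_sum_delta a : a = \sum_g ga_coef a g *: ga_delta F g.
Proof.
apply: ga_eqP => x; rewrite ga_coef_sum (bigD1 x) //= ga_coefZ ga_coef_delta.
rewrite eqxx mulr1 big1 ?addr0 // => g ng.
by rewrite ga_coefZ ga_coef_delta eq_sym (negPf ng) mulr0.
Qed.

(** The anti-automorphism extending inversion in the group; it turns left identities into right
    identities. *)
Definition ga_star a : A := [ffun g => ga_coef a g^-1%g].

Lemma ga_coef_star a g : ga_coef (ga_star a) g = ga_coef a g^-1%g.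
Proof. by rewrite /ga_coef ffunE. Qed.

Lemma ga_starK : involutive ga_star.
Proof. by move=> a; apply: ga_eqP => g; rewrite !ga_coef_star invgK. Qed.

Lemma ga_starD a b : ga_star (a + b) = ga_star a + ga_star b.
Proof. by apply: ga_eqP => g; rewrite !(ga_coef_star, ga_coefD). Qed.

Lemma ga_starZ (k : F) a : ga_star (k *: a) = k *: ga_star a.
Proof. by apply: ga_eqP => g; rewrite !(ga_coef_star, ga_coefZ). Qed.

Lemma ga_star0 : ga_star 0 = 0.
Proof. by rewrite -(scale0r (0 : A)) ga_starZ !scale0r. Qed.

Lemma ga_starM a b : ga_star (a * b) = ga_star b * ga_star a.
Proof.
apply: ga_eqP => g; rewrite ga_coef_star !ga_coefM.
rewrite (reindex_inj (mulgI g^-1%g)); apply: eq_bigr => h _ /=.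
by rewrite !ga_coef_star mulrC !invMg !invgK mulgK.
Qed.

(* Both sides compute the trace of right multiplication by c: on the left in  *)
(* the basis of group elements, on the right through its image, on which c    *)
(* acts as the scalar k.                                                      *)
Lemma ga_quasi_idem_dim c (k : F) : c * c = k *: c ->
  #|gT|%:R * ga_coef c 1%g
    = k * (\dim <<[seq ga_delta F g * c | g <- enum gT]>>)%:R.
Proof.
move=> cc; set V := <<_>>%VS; pose X := vbasis V.
have Vg g : ga_delta F g * c \in V.
  by apply: memv_span; apply: map_f; rewrite mem_enum.
have VX (i : 'I_(\dim V)) : X`_i \in V.
  by apply: vbasis_mem; rewrite mem_nth ?size_tuple.
have Vc x : x \in V -> x * c = k *: x.
  move: x; apply: span_ind => [|u v uc vc|q u uc|_ /mapP[g _ ->]].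
  - by rewrite mul0r scaler0.
  - by rewrite mulrDl uc vc scalerDr.
  - by rewrite -scalerAl uc !scalerA mulrC.
  by rewrite -mulrA cc -scalerAr.
transitivity (\sum_(g : gT) ga_coef (ga_delta F g * c) g).
  rewrite mulr_natl -sumr_const; apply: eq_bigr => g _.
  by rewrite ga_coef_deltal mulVg.
under eq_bigr => g _.
  rewrite {1}(coord_vbasis (Vg g)) ga_coef_sum.
  under eq_bigr do rewrite ga_coefZ mulrC.
  over.
rewrite exchange_big /= -[\dim V in RHS]card_ord mulr_natr -sumr_const.
apply: eq_bigr => i _.
(* Both sides are the i-th diagonal entry of right multiplication by [c] in the basis [X] of its
   image. *)
transitivity (coord X i (X`_i * c)); last first.
  rewrite Vc // linearZ /= coord_free ?eqxx ?mulr1 //.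
  exact: basis_free (vbasisP V).
rewrite {2}(ga_sum_delta X`_i) mulr_suml linear_sum; apply: eq_bigr => g _.
by rewrite -scalerAl linearZ.
Qed.

End GroupAlgebraTheory.

(** * Tableaux and their stabilizers *)

Section Tableaux.
Variable n : nat.
Implicit Types (mu : seq nat) (T U : filling n) (g h s : 'S_n) (k l : 'I_n).

(** With products composed from left to right this is a left action, so that it matches left
    multiplication in the group algebra. *)
Definition tab_act T g : filling n := [ffun k => cell T (g k)].

Lemma cell_act T g k : cell (tab_act T g) k = cell T (g k).
Proof. by rewrite /cell ffunE. Qed.

Lemma cell_conj T k : cell (conj_tableau T) k = ((cell T k).2, (cell T k).1).
Proof. by rewrite /cell ffunE. Qed.

Lemma filling_eqP T U : (forall k, cell T k = cell U k) -> T = U.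
Proof. by move=> eqTU; apply/ffunP. Qed.

Lemma tab_actM T g h : tab_act T (g * h)%g = tab_act (tab_act T h) g.
Proof. by apply: filling_eqP => k; rewrite !cell_act permM. Qed.

Lemma conj_tableauK : involutive (@conj_tableau n).
Proof.
by move=> T; apply: filling_eqP => k; rewrite !cell_conj /= -surjective_pairing.
Qed.

Lemma row_stabP T s :
  reflect (forall k, (cell T (s k)).1 = (cell T k).1) (s \in row_stab T).
Proof.
rewrite inE; apply: (iffP forallP) => [sT k | sT r].
  have /eqP/setP/(_ (s k)) := sT (cell T k).1.
  by rewrite imset_f ?inE // => /esym/eqP.
rewrite eqEcard card_imset ?leqnn ?andbT; last exact: perm_inj.
by apply/subsetP=> _ /imsetP[k + ->]; rewrite !inE sT.
Qed.

Lemma row_stab_conj T : row_stab (conj_tableau T) = col_stab T.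
Proof.
apply/setP=> s; rewrite !inE; apply: eq_forallb => c.
suff -> : tab_row (conj_tableau T) c = tab_col T c by [].
by apply/setP=> k; rewrite !inE cell_conj.
Qed.

Lemma col_stab_conj T : col_stab (conj_tableau T) = row_stab T.
Proof. by rewrite -row_stab_conj conj_tableauK. Qed.

Lemma col_stabP T s :
  reflect (forall k, (cell T (s k)).2 = (cell T k).2) (s \in col_stab T).
Proof.
rewrite -row_stab_conj; apply: (iffP (row_stabP _ _)) => sT k.
  by have := sT k; rewrite !cell_conj.
by rewrite !cell_conj /= sT.
Qed.

Lemma row_stab_group_set T : group_set (row_stab T).
Proof.
apply/group_setP; split=> [|s t /row_stabP sT /row_stabP tT].
  by apply/row_stabP=> k; rewrite perm1.
by apply/row_stabP=> k; rewrite permM tT sT.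
Qed.

Canonical row_stab_group T := group (row_stab_group_set T).

Lemma col_stab_group_set T : group_set (col_stab T).
Proof. by rewrite -row_stab_conj groupP. Qed.

Canonical col_stab_group T := group (col_stab_group_set T).

Lemma mem_row_stab_act T g s :
  (s \in row_stab (tab_act T g)) = ((s ^ g)%g \in row_stab T).
Proof.
apply/row_stabP/row_stabP => sT k.
  by have := sT (g^-1%g k); rewrite !cell_act conjgE !permM permKV.
by have := sT (g k); rewrite !cell_act permJ.
Qed.

Lemma conj_tableau_act T g :
  conj_tableau (tab_act T g) = tab_act (conj_tableau T) g.
Proof. by apply: filling_eqP => k; rewrite !(cell_conj, cell_act). Qed.

Lemma mem_col_stab_act T g s :
  (s \in col_stab (tab_act T g)) = ((s ^ g)%g \in col_stab T).
Proof. by rewrite -!row_stab_conj conj_tableau_act mem_row_stab_act. Qed.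

Lemma mem_diagram mu (c : 'I_n * 'I_n) :
  (c \in diagram n mu) = (c.2 < nth 0%N mu c.1)%N.
Proof. by rewrite inE. Qed.

Lemma tableau_inj mu T : is_tableau mu T -> injective (cell T).
Proof. by case/andP=> /injectiveP. Qed.

Lemma cell_diagram mu T k : is_tableau mu T -> cell T k \in diagram n mu.
Proof. by case/andP=> _ /eqP <-; rewrite imset_f. Qed.

Lemma diagram_cell mu T c :
  is_tableau mu T -> c \in diagram n mu -> exists k, cell T k = c.
Proof. by case/andP=> _ /eqP <- /imsetP[k _ ->]; exists k. Qed.

Lemma card_diagram mu T : is_tableau mu T -> #|diagram n mu| = n.
Proof.
move=> tabT; have/andP[_ /eqP<-] := tabT.
by rewrite card_imset ?cardsT ?card_ord //; apply: tableau_inj tabT.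
Qed.

Lemma is_tableauP mu T : #|diagram n mu| = n -> injective (cell T) ->
  (forall k, cell T k \in diagram n mu) -> is_tableau mu T.
Proof.
move=> card_mu injT mapT; apply/andP; split; first exact/injectiveP.
rewrite eqEcard card_imset // cardsT card_ord card_mu leqnn andbT.
by apply/subsetP=> _ /imsetP[k _ ->].
Qed.

Lemma tab_act_tableau mu T g : is_tableau mu T -> is_tableau mu (tab_act T g).
Proof.
move=> tabT; apply: is_tableauP => [|k l|k]; first exact: card_diagram tabT.
  by rewrite !cell_act => /(tableau_inj tabT)/perm_inj.
by rewrite cell_act cell_diagram.
Qed.

Lemma tab_perm mu T (f : 'I_n -> 'I_n * 'I_n) : is_tableau mu T ->
    injective f -> (forall k, f k \in diagram n mu) ->
  exists s, forall k, cell T (s k) = f k.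
Proof.
(* The default [k] is never reached, since [T] fills the whole diagram. *)
move=> tabT injf mapf; pose h k := odflt k [pick l | cell T l == f k].
have hP k : cell T (h k) = f k.
  rewrite /h; case: pickP => [l /eqP //|no_l].
  by have [l eq_l] := diagram_cell tabT (mapf k); have := no_l l; rewrite eq_l eqxx.
have injh : injective h by move=> k l eq_h; apply: injf; rewrite -!hP eq_h.
by exists (perm injh) => k; rewrite permE hP.
Qed.

Lemma tableau_trans mu T U : is_tableau mu T -> is_tableau mu U ->
  exists g, U = tab_act T g.
Proof.
move=> tabT tabU.
have [g gP] := tab_perm tabT (tableau_inj tabU) (fun k => cell_diagram k tabU).
by exists g; apply: filling_eqP => k; rewrite cell_act gP.
Qed.

(* The function h(i, j) = 2 (mu_i - j) - 1 is positive exactly on the diagram *)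
(* of mu. Since it is the sum of a function of i and a function of j, its sum *)
(* over the n mixed cells equals its sum over the diagram, so that these n    *)
(* distinct cells must fill the diagram.                                      *)
Lemma mixed_cells_diagram mu T U :
    is_tableau mu T -> is_tableau mu U ->
    injective (fun k => ((cell U k).1, (cell T k).2)) ->
  forall k, ((cell U k).1, (cell T k).2) \in diagram n mu.
Proof.
move=> tabT tabU; set f := fun k => _ => injf.
pose h (c : 'I_n * 'I_n) : int := (nth 0%N mu c.1)%:Z *+ 2 - (c.2%:Z *+ 2 + 1).
have h_pos c : c \in diagram n mu -> 0 < h c.
  by rewrite mem_diagram /h; case: c => i j /=; lia.
have h_neg c : c \notin diagram n mu -> h c < 0.
  by rewrite mem_diagram /h; case: c => i j /=; lia.
have sum_tab V (h' : 'I_n * 'I_n -> int) : is_tableau mu V ->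
    \sum_k h' (cell V k) = \sum_(c in diagram n mu) h' c.
  move=> tabV; have/andP[_ /eqP<-] := tabV.
  rewrite big_imset /=; last by move=> k l _ _ /(tableau_inj tabV).
  by apply: eq_bigl => k; rewrite inE.
have sum_f : \sum_(c in f @: [set: 'I_n]) h c = \sum_(c in diagram n mu) h c.
  rewrite big_imset /=; last by move=> k l _ _ /injf.
  rewrite /h sumrB -!(sum_tab T) // [RHS]sumrB; congr (_ - _).
    rewrite (sum_tab T (fun c => (nth 0%N mu c.1)%:Z *+ 2)) //.
    by rewrite -(sum_tab U) //; apply: eq_bigl => k; rewrite inE.
  by apply: eq_bigl => k; rewrite inE.
move: sum_f; set S := f @: _; set D := diagram n mu.
rewrite (big_setID D) [RHS](big_setID S) /= setIC => /addrI sum_f.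
have sum_ge0 : 0 <= \sum_(c in D :\: S) h c.
  by apply: Num.Theory.sumr_ge0 => c /setDP[/h_pos/Order.POrderTheory.ltW].
move=> k; apply: contraLR isT => fk_nD.
have Sfk : f k \in S :\: D by rewrite inE fk_nD imset_f.
move: sum_ge0; rewrite -sum_f (bigD1 (f k)) //=.
have := h_neg _ fk_nD.
suff : \sum_(c in S :\: D | c != f k) h c <= 0 by move: (h _) (\sum_(_ | _) _); lia.
apply: Num.Theory.sumr_le0 => c /andP[/setDP[_ /h_neg]] + _.
exact: Order.POrderTheory.ltW.
Qed.

(** The cells taking their row from [tab_act T g] and their column from [T] are distinct, so by
    [mixed_cells_diagram] they lie in the diagram. Moving each entry to its mixed cell is a column
    permutation [s], and what remains of [g] preserves rows. *)
Lemma row_col_factor mu T g : is_tableau mu T ->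
    (forall k l, (cell T k).2 = (cell T l).2 ->
       (cell T (g k)).1 = (cell T (g l)).1 -> k = l) ->
  exists s r, [/\ s \in col_stab T, r \in row_stab T & g = (s * r)%g].
Proof.
move=> tabT no_pair; pose f k := ((cell (tab_act T g) k).1, (cell T k).2).
have injf : injective f.
  by move=> k l [+ +]; rewrite !cell_act => /[swap]; apply: no_pair.
have [s sP] := tab_perm tabT injf
  (mixed_cells_diagram tabT (tab_act_tableau g tabT) injf).
exists s, (s^-1 * g)%g; split; last by rewrite mulKVg.
  by apply/col_stabP=> k; rewrite sP.
apply/row_stabP=> k; rewrite permM -{2}(permKV s k) sP.
by rewrite /f /= cell_act.
Qed.

Lemma row_stab_tperm T k l :
  (cell T k).1 = (cell T l).1 -> tperm k l \in row_stab T.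
Proof. by move=> kl; apply/row_stabP=> m; case: tpermP => // ->. Qed.

Lemma col_stab_tperm T k l :
  (cell T k).2 = (cell T l).2 -> tperm k l \in col_stab T.
Proof. by move=> kl; apply/col_stabP=> m; case: tpermP => // ->. Qed.

Lemma row_col_stab_cap mu T s : is_tableau mu T ->
  s \in row_stab T -> s \in col_stab T -> s = 1%g.
Proof.
move=> tabT /row_stabP rs /col_stabP cs; apply/permP=> k; rewrite perm1.
apply: (tableau_inj tabT); move: (rs k) (cs k).
by case: (cell T (s k)) (cell T k) => [i j] [i' j'] /= -> ->.
Qed.

End Tableaux.

(** * Young symmetrizers *)

Section YoungSymmetrizers.
Variables (F : finFieldType) (n : nat).
Notation A := (group_algebra F 'S_n).
Notation "\d g" := (ga_delta F g) (at level 8, g at level 2).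
Implicit Types (mu : seq nat) (T U : filling n) (g h s r : 'S_n) (x y : A).

Definition psign s : F := (-1) ^+ odd_perm s.

Lemma psignM g h : psign (g * h)%g = psign g * psign h.
Proof. by rewrite /psign odd_permM signr_addb. Qed.

Lemma psignV g : psign g^-1%g = psign g.
Proof. by rewrite /psign odd_permV. Qed.

Lemma psign1 : psign 1%g = 1.
Proof. by rewrite /psign odd_perm1. Qed.

Lemma psign_sq g : psign g * psign g = 1.
Proof. by rewrite -expr2 sqrr_sign. Qed.

Lemma psign_tperm k l : k != l -> psign (tperm k l) = -1.
Proof. by move=> ne_kl; rewrite /psign odd_tperm ne_kl expr1. Qed.

Lemma psignJ g h : psign (g ^ h)%g = psign g.
Proof. by rewrite /psign odd_permJ. Qed.

Definition row_sum T : A := \sum_(r in row_stab T) \d r.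
(** Arbitrary sets are allowed because the Garnir relations use the symmetric group of a set of
    entries as well as column stabilizers. *)
Definition alt_sum (B : {set 'S_n}) : A := \sum_(s in B) psign s *: \d s.
Definition col_sum T : A := alt_sum (col_stab T).
Definition young_sym T : A := col_sum T * row_sum T.

Lemma young_idemE mu T : young_idem F mu T
  = ((num_std n mu)%:R / (n`!)%:R : F) *: young_sym T.
Proof.
rewrite /young_idem /young_sym mulr_sumr; congr (_ *: _); apply: eq_bigr => r _.
by rewrite mulr_suml; apply: eq_bigr => s _; rewrite -scalerAl ga_deltaM.
Qed.

Lemma young_idem_barE mu T : young_idem_bar F mu T
  = ((num_std n mu)%:R / (n`!)%:R : F) *: (row_sum T * col_sum T).
Proof.
rewrite /young_idem_bar mulr_suml; congr (_ *: _); apply: eq_bigr => r _.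
by rewrite mulr_sumr; apply: eq_bigr => s _; rewrite -scalerAr ga_deltaM.
Qed.

Lemma coef_row_sum T g : ga_coef (row_sum T) g = (g \in row_stab T)%:R.
Proof.
rewrite ga_coef_sum; under eq_bigr do rewrite ga_coef_delta.
have [gT|gT] := boolP (g \in row_stab T).
  rewrite (bigD1 g) //= eqxx big1 ?addr0 // => s /andP[_ ns].
  by rewrite eq_sym (negPf ns).
by rewrite big1 // => s sT; case: eqP gT => // ->; rewrite sT.
Qed.

Lemma coef_alt_sum (B : {set 'S_n}) g :
  ga_coef (alt_sum B) g = psign g * (g \in B)%:R.
Proof.
rewrite ga_coef_sum; under eq_bigr do rewrite ga_coefZ ga_coef_delta.
have [gB|gB] := boolP (g \in B).
  rewrite (bigD1 g) //= eqxx big1 ?addr0 // => s /andP[_ ns].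
  by rewrite eq_sym (negPf ns) mulr0.
rewrite mulr0 big1 // => s sB; case: eqP gB => [->|_ _]; first by rewrite sB.
by rewrite mulr0.
Qed.

Lemma row_sum_deltal T r : r \in row_stab T -> \d r * row_sum T = row_sum T.
Proof.
move=> rT; apply: ga_eqP => g.
by rewrite ga_coef_deltal !coef_row_sum groupMl ?groupV.
Qed.

Lemma row_sum_deltar T r : r \in row_stab T -> row_sum T * \d r = row_sum T.
Proof.
move=> rT; apply: ga_eqP => g.
by rewrite ga_coef_deltar !coef_row_sum groupMr ?groupV.
Qed.

Lemma alt_sum_deltal (G : {group 'S_n}) s :
  s \in G -> \d s * alt_sum G = psign s *: alt_sum G.
Proof.
move=> sG; apply: ga_eqP => g.
rewrite ga_coef_deltal ga_coefZ !coef_alt_sum groupMl ?groupV //.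
by rewrite psignM psignV mulrA.
Qed.

Lemma alt_sum_deltar (G : {group 'S_n}) s :
  s \in G -> alt_sum G * \d s = psign s *: alt_sum G.
Proof.
move=> sG; apply: ga_eqP => g.
rewrite ga_coef_deltar ga_coefZ !coef_alt_sum groupMr ?groupV //.
by rewrite psignM psignV mulrA [psign g * _]mulrC.
Qed.

Lemma col_sum_deltal T s :
  s \in col_stab T -> \d s * col_sum T = psign s *: col_sum T.
Proof. exact: alt_sum_deltal. Qed.

Lemma row_sum_act T g : row_sum (tab_act T g) * \d g = \d g * row_sum T.
Proof.
apply: ga_eqP => h; rewrite ga_coef_deltar ga_coef_deltal !coef_row_sum.
by rewrite mem_row_stab_act conjgE mulgKV.
Qed.

Lemma col_sum_act T g : col_sum (tab_act T g) * \d g = \d g * col_sum T.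
Proof.
apply: ga_eqP => h; rewrite ga_coef_deltar ga_coef_deltal !coef_alt_sum.
rewrite mem_col_stab_act -(psignJ _ g) conjgE mulgKV.
by [].
Qed.

Lemma young_sym_act T g : young_sym (tab_act T g) * \d g = \d g * young_sym T.
Proof. by rewrite -mulrA row_sum_act mulrA col_sum_act mulrA. Qed.

Lemma star_row_sum T : ga_star (row_sum T) = row_sum T.
Proof.
by apply: ga_eqP => g; rewrite ga_coef_star !coef_row_sum groupV.
Qed.

Lemma star_col_sum T : ga_star (col_sum T) = col_sum T.
Proof.
by apply: ga_eqP => g; rewrite ga_coef_star !coef_alt_sum groupV psignV.
Qed.

Lemma star_young_sym T : ga_star (young_sym T) = row_sum T * col_sum T.
Proof. by rewrite ga_starM star_row_sum star_col_sum. Qed.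

Lemma coef_young_sym1 mu T : is_tableau mu T -> ga_coef (young_sym T) 1%g = 1.
Proof.
move=> tabT; rewrite ga_coefM (bigD1 1%g) //= coef_alt_sum coef_row_sum.
rewrite psign1 invg1 mulg1 !group1 !mulr1 big1 ?addr0 // => g ng1.
rewrite coef_alt_sum coef_row_sum mulg1 groupV.
have [gc|] := boolP (g \in col_stab T); last by rewrite mulr0 mul0r.
have [gr|] := boolP (g \in row_stab T); last by rewrite mulr0.
by rewrite (row_col_stab_cap tabT gr gc) eqxx in ng1.
Qed.

Hypothesis nfact_neq0 : n`!%:R != 0 :> F.

Lemma nat_le_neq0 m : (0 < m <= n)%N -> m%:R != 0 :> F.
Proof.
move=> /dvdn_fact/dvdnP[k eq_nf]; apply: contraNneq nfact_neq0 => m0.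
by rewrite eq_nf natrM m0 mulr0.
Qed.

(** Two distinct indices force n to be at least 2, so 2 divides n! and is invertible in [F]. *)
Lemma eq_opp_eq0 (k l : 'I_n) (a : F) : k != l -> a = - a -> a = 0.
Proof.
move=> ne_kl /eqP; rewrite -addr_eq0 -mulr2n -mulr_natr mulf_eq0 => /orP[/eqP//|].
rewrite (negPf (nat_le_neq0 _)) //=.
by move: ne_kl (ltn_ord k) (ltn_ord l); rewrite -val_eqE /=; lia.
Qed.

Lemma ga_eq_opp_eq0 (k l : 'I_n) (x : A) : k != l -> x = - x -> x = 0.
Proof.
move=> ne_kl xN; apply: ga_eqP => g; apply: etrans (_ : 0 = _).
  apply: eq_opp_eq0 ne_kl _; rewrite {1}xN -scaleN1r ga_coefZ.
  by rewrite mulN1r.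
by rewrite /ga_coef ffunE.
Qed.

(* Von Neumann's lemma: if g is not in the product of the column and row      *)
(* stabilizers, then some transposition t in the former satisfies t g = g r   *)
(* with r in the latter, so that the coefficient of y at g is its own         *)
(* opposite.                                                                  *)
Lemma young_sym_unique mu T y : is_tableau mu T ->
    (forall s, s \in col_stab T -> \d s * y = psign s *: y) ->
    (forall r, r \in row_stab T -> y * \d r = y) ->
  y = ga_coef y 1%g *: young_sym T.
Proof.
move=> tabT.
have coefE z (s r : 'S_n) : 
    (forall s, s \in col_stab T -> \d s * z = psign s *: z) ->
    (forall r, r \in row_stab T -> z * \d r = z) ->
    s \in col_stab T -> r \in row_stab T ->
    ga_coef z (s * r)%g = psign s * ga_coef z 1%g.
  move=> zC zR sC rR; rewrite -{1}(zR _ rR) ga_coef_deltar mulgK.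
  rewrite -[RHS]ga_coefZ -[psign s]psignV -zC ?groupV //.
  by rewrite ga_coef_deltal invgK mulg1.
have coef0 z g : 
    (forall s, s \in col_stab T -> \d s * z = psign s *: z) ->
    (forall r, r \in row_stab T -> z * \d r = z) ->
    forall k l, k != l -> (cell T k).2 = (cell T l).2 ->
      (cell T (g k)).1 = (cell T (g l)).1 -> ga_coef z g = 0.
  move=> zC zR k l ne_kl kl_col kl_row; apply: (eq_opp_eq0 ne_kl).
  have := zC _ (col_stab_tperm kl_col); rewrite psign_tperm // scaleN1r => zN.
  rewrite -mulN1r -ga_coefZ scaleN1r -zN ga_coef_deltal tpermV.
  rewrite -{1}(zR _ (row_stab_tperm kl_row)) ga_coef_deltar tpermV -tpermJ.
  by rewrite conjgE mulgA mulgA mulgV mul1g.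
move=> yC yR; apply: ga_eqP => g; rewrite ga_coefZ.
have cC s : s \in col_stab T -> \d s * young_sym T = psign s *: young_sym T.
  by move=> sC; rewrite mulrA col_sum_deltal // -scalerAl.
have cR r : r \in row_stab T -> young_sym T * \d r = young_sym T.
  by move=> rR; rewrite -mulrA row_sum_deltar.
have [pair|no_pair] := boolP [exists k, exists l, [&& k != l,
    (cell T k).2 == (cell T l).2 & (cell T (g k)).1 == (cell T (g l)).1]].
  case/existsP: pair => k /existsP[l /and3P[kl /eqP kl_col /eqP kl_row]].
  rewrite (coef0 y g yC yR k l) // (coef0 _ g cC cR k l) //.
  by rewrite mulr0.
have [k l kl_col kl_row|s [r [sC rR ->]]] := @row_col_factor _ mu T g tabT.
  apply/eqP; apply: contraNT no_pair => ne_kl; apply/existsP; exists k.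
  by apply/existsP; exists l; rewrite ne_kl kl_col kl_row !eqxx.
by rewrite !coefE // (coef_young_sym1 tabT) mulr1 mulrC.
Qed.

Lemma young_sym_sandwich mu T x : is_tableau mu T ->
  exists k : F, young_sym T * x * young_sym T = k *: young_sym T.
Proof.
move=> tabT; set y := _ * x * _; exists (ga_coef y 1%g).
apply: (young_sym_unique tabT) => [s sC|r rR].
  by rewrite /y !mulrA col_sum_deltal // -!scalerAl.
by rewrite /y -!mulrA row_sum_deltar.
Qed.

(** The transposition of [k] and [l] is absorbed by the row sum and changes the sign of the column
    sum. *)
Lemma row_col_sum_eq0 T U k l : k != l ->
    (cell T k).1 = (cell T l).1 -> (cell U k).2 = (cell U l).2 ->
  row_sum T * col_sum U = 0.
Proof.
move=> ne_kl kl_row kl_col; apply: (ga_eq_opp_eq0 ne_kl).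
rewrite -{1}(row_sum_deltar (row_stab_tperm kl_row)) -mulrA.
by rewrite col_sum_deltal ?col_stab_tperm // psign_tperm // scaleN1r mulrN.
Qed.

Lemma alt_row_sum_eq0 (G : {group 'S_n}) T k l : k != l ->
    tperm k l \in G -> (cell T k).1 = (cell T l).1 ->
  alt_sum G * row_sum T = 0.
Proof.
move=> ne_kl klG kl_row; apply: (ga_eq_opp_eq0 ne_kl).
rewrite -{1}(row_sum_deltal (row_stab_tperm kl_row)) mulrA.
by rewrite alt_sum_deltar // psign_tperm // scaleN1r mulNr.
Qed.

Lemma young_sym_mul_eq0 T U k l : k != l ->
    (cell T k).1 = (cell T l).1 -> (cell U k).2 = (cell U l).2 ->
  young_sym T * young_sym U = 0.
Proof.
move=> ne_kl kl_row kl_col.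
by rewrite -mulrA [row_sum T * _]mulrA (row_col_sum_eq0 ne_kl) // mul0r mulr0.
Qed.

(** The trace identity shows that [k] is nonzero before the dimension is known. *)
Lemma young_sym_quasi_idem mu T : is_tableau mu T ->
  exists k : F, [/\ k != 0, young_sym T * young_sym T = k *: young_sym T
    & n`!%:R = k * (\dim <<[seq \d g * young_sym T | g <- enum 'S_n]>>)%:R].
Proof.
move=> tabT; have [k] := young_sym_sandwich 1 tabT; rewrite mulr1 => cc.
have := ga_quasi_idem_dim cc; rewrite (coef_young_sym1 tabT) mulr1.
rewrite card_Sn => dim_eq; exists k; split=> //.
by apply: contraNneq nfact_neq0 => k0; rewrite dim_eq k0 mul0r.
Qed.

End YoungSymmetrizers.

(** * Standard tableaux *)

Section StandardTableaux.
Variable n : nat.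
Implicit Types (mu : seq nat) (T U V : filling n) (g h s : 'S_n) (k l : 'I_n).

Lemma partition_nth_mono mu i j : is_partition n mu -> (i <= j)%N ->
  (nth 0 mu j <= nth 0 mu i)%N.
Proof.
case/and3P=> sort_mu _ _ le_ij.
have [lt_j|] := ltnP j (size mu); last by move=> le_j; rewrite (nth_default 0%N le_j).
have geq_trans : transitive geq by move=> a b c ba ac; apply: leq_trans ac ba.
apply: (sorted_leq_nth geq_trans (fun a => leqnn a) 0%N sort_mu) => //.
by rewrite inE (leq_ltn_trans le_ij).
Qed.

Lemma diagram_down mu (i j i' j' : 'I_n) : is_partition n mu ->
    (i, j) \in diagram n mu -> (i' <= i)%N -> (j' <= j)%N ->
  (i', j') \in diagram n mu.
Proof.
move=> part; rewrite !mem_diagram /= => lt_j le_i le_j.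
by have := partition_nth_mono part le_i; lia.
Qed.

Lemma is_standardP mu T :
  reflect [/\ is_tableau mu T,
    forall k l, (cell T k).1 = (cell T l).1 ->
      ((cell T k).2 < (cell T l).2)%N -> (k < l)%N
    & forall k l, (cell T k).2 = (cell T l).2 ->
      ((cell T k).1 < (cell T l).1)%N -> (k < l)%N]
  (is_standard mu T).
Proof.
apply: (iffP and3P) => [[tabT rowT colT] | [tabT rowT colT]]; split=> //.
- move=> k l eq_r lt_c.
  by move/forallP/(_ k)/forallP/(_ l): rowT; rewrite eq_r eqxx lt_c.
- move=> k l eq_c lt_r.
  by move/forallP/(_ k)/forallP/(_ l): colT; rewrite eq_c eqxx lt_r.
- apply/forallP=> k; apply/forallP=> l; apply/implyP=> /andP[/eqP].
  exact: rowT.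
- apply/forallP=> k; apply/forallP=> l; apply/implyP=> /andP[/eqP].
  exact: colT.
Qed.

(** Strong induction on [k]: if [k] lay further left in one tableau, the other would hold in that
    cell some [l] smaller than [k]; by induction [l] occupies the same cell in both, hence equals
    [k]. *)
Lemma standard_eq_of_rows mu U V m : is_standard mu U -> is_standard mu V ->
    (forall k, (k < m)%N -> (cell U k).1 = (cell V k).1) ->
  forall k, (k < m)%N -> cell U k = cell V k.
Proof.
move=> + + + k; have [d] := ubnP (val k); elim: d U V k => // d IHd U V k le_d.
move=> stU stV eq_r lt_km.
have no_lt U' V' : is_standard mu U' -> is_standard mu V' ->
    (forall l, (l < m)%N -> (cell U' l).1 = (cell V' l).1) ->
    ~~ ((cell U' k).2 < (cell V' k).2)%N.
  move=> stU' stV' eq_r'; apply/negP => lt_c.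
  have [tabU' _ _] := is_standardP _ _ stU'.
  have [tabV' rowV' _] := is_standardP _ _ stV'.
  have [l cell_l] := diagram_cell tabV' (cell_diagram k tabU').
  have lt_lk : (l < k)%N by apply: rowV'; rewrite cell_l // eq_r'.
  have := IHd U' V' l (leq_trans lt_lk le_d) stU' stV' eq_r' (ltn_trans lt_lk lt_km).
  by rewrite cell_l => /(tableau_inj tabU') lk; rewrite lk ltnn in lt_lk.
have := no_lt U V stU stV eq_r; have := no_lt V U stV stU (fun l lm => esym (eq_r l lm)).
rewrite -!leqNgt => le1 le2; have := eq_r k lt_km.
case: (cell U k) (cell V k) le1 le2 => [i j] [i' j'] /= le1 le2 ->.
by congr pair; apply/val_inj/eqP; rewrite eqn_leq le1 le2.
Qed.

Definition row_word T : n.-tuplelexi nat :=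
  [tuple ((cell T k).1 : nat) | k < n].

(** At the first difference [l], [U] puts [l] in a higher row than [V] does. The cell of that row in
    the column of [l] in [V] holds a smaller entry [k], which has the same cell in [U]. *)
Lemma standard_row_word_le mu U V : is_partition n mu ->
    is_standard mu U -> is_standard mu V -> U != V ->
    (row_word U <= row_word V)%O ->
  exists k l, [/\ k != l, (cell U k).1 = (cell U l).1
    & (cell V k).2 = (cell V l).2].
Proof.
move=> part stU stV ne_UV /lexi_tupleP[m mP].
have eq_r k : (k < m)%N -> (cell U k).1 = (cell V k).1.
  move=> lt_km; have [_] := mP k (ltnW lt_km).
  by rewrite !tnth_mktuple (ltn_eqF lt_km) => /eqP/val_inj.
have eq_cell := standard_eq_of_rows stU stV eq_r.
(* The index [m] may a priori be n, the case of equal words; then the tableaux would coincide. *)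
have lt_mn : (m < n)%N.
  rewrite ltn_neqAle -ltnS ltn_ord andbT; apply: contra ne_UV => /eqP mn.
  by apply/eqP/filling_eqP => k; rewrite eq_cell ?mn.
pose l := Ordinal lt_mn; have [tabV rowV colV] := is_standardP _ _ stV.
have lt_r : ((cell U l).1 < (cell V l).1)%N.
  have [le_r eq_rF] := mP l (leqnn _); move: le_r eq_rF.
  by rewrite !tnth_mktuple eqxx Order.NatOrder.leEnat ltn_neqAle => -> ->.
have V_l : ((cell V l).1, (cell V l).2) \in diagram n mu.
  by rewrite -surjective_pairing cell_diagram.
have [k cell_k] := diagram_cell tabV (diagram_down part V_l (ltnW lt_r) (leqnn _)).
have lt_kl : (k < l)%N by apply: colV; rewrite cell_k.
exists k, l; split; last by rewrite cell_k.
  by rewrite -val_eqE neq_ltn lt_kl.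
by rewrite eq_cell // cell_k.
Qed.

(** Since [c] and its rearrangement have equal sums, twice the difference of the two sides is the
    sum of (2k + 1 - 2x)(c(g k) - c k). The odd factor never vanishes and changes sign exactly at
    [x], so each term is nonnegative and that of [k0] is positive. *)
Lemma rearrangement (c : 'I_n -> nat) g (x : nat) :
    (forall k, (k < x)%N -> (c (g k) <= c k)%N) ->
    (forall k, (x <= k)%N -> (c k <= c (g k))%N) ->
    (exists k, c (g k) != c k) ->
  (\sum_(k < n) k * c k < \sum_(k < n) k * c (g k))%N.
Proof.
move=> below above [k0 ne_k0].
have eq_sum : (\sum_(k < n) c (g k) = \sum_(k < n) c k)%N.
  by rewrite [RHS](reindex_inj (@perm_inj _ g)).
suff : (\sum_(k < n) ((2 * k + 1) * c k + 2 * x * c (g k))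
    < \sum_(k < n) ((2 * k + 1) * c (g k) + 2 * x * c k))%N.
  rewrite !big_split /= -!big_distrr /= eq_sum ltn_add2r.
  under eq_bigr do rewrite mulnDl mul1n -mulnA.
  under [X in (_ < X)%N]eq_bigr do rewrite mulnDl mul1n -mulnA.
  rewrite [ltnLHS]big_split [ltnRHS]big_split /= eq_sum ltn_add2r.
  by rewrite -!big_distrr /= ltn_mul2l.
rewrite (bigD1 k0) //= [X in (_ < X)%N](bigD1 k0) //= -addSn leq_add //.
  by have := below k0; have := above k0; have [lt_x|le_x] := ltnP k0 x; nia.
apply: leq_sum => k _.
by have := below k; have := above k; have [lt_x|le_x] := ltnP k x; nia.
Qed.

(* Lexicographic: the row part is at most n^3. A Garnir exchange increases    *)
(* the column part, and sorting a column increases the row part.              *)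
Definition tab_weight T : nat :=
  (\sum_(k < n) k * (cell T k).2) * (n * n * n).+1 + \sum_(k < n) k * (cell T k).1.

Lemma sum_weight_le (c : 'I_n -> 'I_n) : (\sum_(k < n) k * c k <= n * n * n)%N.
Proof.
apply: (@leq_trans (\sum_(k < n) n * n)); first apply: leq_sum => k _.
  by rewrite leq_mul // ltnW.
by rewrite sum_nat_const card_ord mulnA.
Qed.

Lemma tab_weight_le T :
  (tab_weight T <= n * n * n * (n * n * n).+1 + n * n * n)%N.
Proof. by rewrite leq_add ?leq_mul ?sum_weight_le. Qed.

Lemma tab_weight_col_lt T g (x : nat) :
    (forall k, (k < x)%N -> ((cell T (g k)).2 <= (cell T k).2)%N) ->
    (forall k, (x <= k)%N -> ((cell T k).2 <= (cell T (g k)).2)%N) ->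
    g \notin col_stab T ->
  (tab_weight T < tab_weight (tab_act T g))%N.
Proof.
move=> below above gT; rewrite /tab_weight.
have -> : (\sum_(k < n) k * (cell (tab_act T g) k).2
    = \sum_(k < n) k * (cell T (g k)).2)%N.
  by apply: eq_bigr => k _; rewrite cell_act.
have ex_k : exists k, ((cell T (g k)).2 : nat) != (cell T k).2.
  apply/existsP; apply: contraNT gT => /existsPn ck.
  by apply/col_stabP => k; apply/val_inj/eqP; have := ck k; rewrite negbK.
have := @rearrangement (fun k => (cell T k).2 : nat) g x below above ex_k.
have := sum_weight_le (fun k => (cell T k).1).
move: (n * n * n)%N => N le_N lt_c.
apply: leq_trans (leq_addr _ _); apply: leq_trans (leq_mul lt_c (leqnn N.+1)).
by rewrite mulSn [ltnLHS]addnC ltn_add2r ltnS.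
Qed.

Lemma tab_weight_swap T k l : (k < l)%N ->
    (cell T k).2 = (cell T l).2 -> ((cell T l).1 < (cell T k).1)%N ->
  (tab_weight T < tab_weight (tab_act T (tperm k l)))%N.
Proof.
move=> lt_kl eq_c lt_r; rewrite /tab_weight.
have -> : (\sum_(m < n) m * (cell (tab_act T (tperm k l)) m).2
    = \sum_(m < n) m * (cell T m).2)%N.
  by apply: eq_bigr => m _; rewrite cell_act; case: tpermP => // ->; rewrite eq_c.
rewrite ltn_add2l.
under [X in (_ < X)%N]eq_bigr do rewrite cell_act.
apply: (@rearrangement (fun k => (cell T k).1 : nat) _ l).
- move=> m lt_m; case: tpermP => [->|eq_m|//]; first exact: ltnW.
  by rewrite eq_m ltnn in lt_m.
- move=> m le_m; case: tpermP => [eq_m|->|//]; last exact: ltnW.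
  by rewrite eq_m leqNgt lt_kl in le_m.
by exists k; rewrite tpermL neq_ltn lt_r.
Qed.

End StandardTableaux.

(** * The standard basis of the left ideal of a Young symmetrizer *)

Section SpechtBasis.
Variables (F : finFieldType) (n : nat).
Hypothesis nfact_neq0 : n`!%:R != 0 :> F.
Notation A := (group_algebra F 'S_n).
Notation "\d g" := (ga_delta F g) (at level 8, g at level 2).
Implicit Types (mu : seq nat) (T U : filling n) (g h s r : 'S_n) (x y : A).
Implicit Types k l : 'I_n.

(* Under a column permutation of U the entries of X and Y only meet the rows  *)
(* of the column of k, the longer of the two columns, and there is one entry  *)
(* more than there are rows; so two of them share a row, and transposing them *)
(* shows that every term of the expanded product vanishes.                    *)
Lemma garnir_relation mu U k l : is_partition n mu -> is_tableau mu U ->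
    (cell U k).1 = (cell U l).1 -> ((cell U k).2 < (cell U l).2)%N ->
  let X := [set m | ((cell U m).2 == (cell U k).2)
                    && ((cell U k).1 <= (cell U m).1)%N] in
  let Y := [set m | ((cell U m).2 == (cell U l).2)
                    && ((cell U m).1 <= (cell U l).1)%N] in
  alt_sum F (Sym (X :|: Y)) * young_sym F U = 0.
Proof.
move=> part tabU eq_r lt_c X Y; set Z := X :|: Y.
have XYdisj : X :&: Y = set0.
  apply/setP=> m; rewrite !inE; apply/negbTE/negP => /andP[/andP[/eqP-> _]].
  by case/andP=> /eqP eq_c; rewrite eq_c ltnn in lt_c.
have U_row m : ((cell U m).1, (cell U m).2) \in diagram n mu.
  by rewrite -surjective_pairing cell_diagram.
pose rows := [set i | (i, (cell U k).2) \in diagram n mu].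
have card_Z : (#|rows| < #|Z|)%N.
  (* Rows put [X] and [Y] in bijection with [RX] and [RY], which cover [rows] and overlap in the
     common row of [k] and [l]. *)
  pose RX := [set i in rows | (cell U k).1 <= i]%N.
  pose RY := [set i : 'I_n | i <= (cell U l).1]%N.
  have <- : (#|RX :|: RY| + #|RX :&: RY| = #|Z|)%N.
    rewrite cardsUI cardsU XYdisj cards0 subn0.
    congr (_ + _)%N.
      rewrite -[in RHS](card_in_imset (f := fun m => (cell U m).1)).
        apply: eq_card => i; apply/idP/imsetP => [|[m mX ->]].
          rewrite inE => /andP[]; rewrite inE => /(diagram_cell tabU)[m cell_m] le_i.
          by exists m; rewrite ?inE cell_m ?eqxx.
        move: mX; rewrite inE => /andP[/eqP eq_c le_r].
        by rewrite inE le_r andbT inE -eq_c.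
      move=> m m'; rewrite !inE => /andP[/eqP c_m _] /andP[/eqP c_m' _] eq_m.
      apply: (tableau_inj tabU); move: c_m c_m' eq_m.
      by case: (cell U m) (cell U m') => [i j] [i' j'] /= -> -> ->.
    rewrite -[in RHS](card_in_imset (f := fun m => (cell U m).1)).
      apply: eq_card => i; apply/idP/imsetP => [|[m mY ->]].
        rewrite !inE => le_i.
        have [m cell_m] := diagram_cell tabU (diagram_down part (U_row l) le_i (leqnn _)).
        by exists m; rewrite ?inE cell_m ?eqxx.
      by move: mY; rewrite !inE => /andP[].
    move=> m m'; rewrite !inE => /andP[/eqP c_m _] /andP[/eqP c_m' _] eq_m.
    apply: (tableau_inj tabU); move: c_m c_m' eq_m.
    by case: (cell U m) (cell U m') => [i j] [i' j'] /= -> -> ->.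
  rewrite -addn1 leq_add //.
    apply/subset_leq_card/subsetP => i i_row; rewrite !inE in i_row *.
    by rewrite i_row eq_r leq_total.
  apply/card_gt0P; exists (cell U k).1.
  by rewrite inE [_ \in RX]inE [_ \in rows]inE U_row inE eq_r !leqnn.
have -> : alt_sum F (Sym Z) * young_sym F U = \sum_(s in col_stab U)
    psign F s *: (alt_sum F (Sym Z) * (\d s * row_sum F U)).
  rewrite [young_sym F U]mulr_suml mulr_sumr; apply: eq_bigr => s _.
  by rewrite -scalerAl -scalerAr.
rewrite big1 // => s sC; rewrite -row_sum_act mulrA.
have [u [v [uZ vZ ne_uv eq_uv]]] : exists u v,
    [/\ u \in Z, v \in Z, u != v & (cell U (s u)).1 = (cell U (s v)).1].
  have [inj|] := boolP [forall u in Z, forall v in Z,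
      ((cell U (s u)).1 == (cell U (s v)).1) ==> (u == v)].
    have inj_f : {in Z &, injective (fun u => (cell U (s u)).1)}.
      move=> u v uZ vZ eq_uv; apply/eqP.
      move/forallP/(_ u): inj; rewrite uZ => /forallP/(_ v).
      by rewrite vZ eq_uv eqxx.
    have sub : [set (cell U (s u)).1 | u in Z] \subset rows.
      apply/subsetP=> _ /imsetP[u uZ ->]; rewrite inE.
      apply: (diagram_down part (U_row (s u))) => //.
      rewrite (col_stabP _ _ sC); move: uZ; rewrite !inE.
      by case/orP=> /andP[/eqP-> _] //; apply: ltnW.
    have := subset_leq_card sub; rewrite card_in_imset // => le_Z.
    by rewrite ltnNge le_Z in card_Z.
  rewrite negb_forall => /existsP[u]; rewrite negb_imply => /andP[uZ].
  rewrite negb_forall => /existsP[v]; rewrite !negb_imply.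
  by case/and3P=> vZ /eqP eq_uv ne_uv; exists u, v.
rewrite (alt_row_sum_eq0 nfact_neq0 ne_uv) ?mul0r ?scaler0 //.
  rewrite inE; apply/subsetP=> m; rewrite inE.
  by case: tpermP => [->|->|] //; rewrite eqxx.
by rewrite !cell_act.
Qed.

Lemma young_sym_act_col T g s : s \in col_stab (tab_act T g) ->
  \d (s * g)%g * young_sym F T = psign F s *: (\d g * young_sym F T).
Proof.
move=> sC; rewrite ga_deltaM -mulrA -young_sym_act mulrA.
by rewrite /young_sym mulrA col_sum_deltal // -!scalerAl.
Qed.

Definition std_perms mu T : {set 'S_n} :=
  [set g | is_standard mu (tab_act T g)].

Lemma card_std_perms mu T : is_tableau mu T -> #|std_perms mu T| = num_std n mu.
Proof.
move=> tabT; rewrite /num_std.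
have inj : injective (tab_act T).
  move=> g h eq_gh; apply/permP => k; apply: (tableau_inj tabT).
  by rewrite -!cell_act eq_gh.
rewrite -(card_imset _ inj); apply: eq_card => U; rewrite inE.
apply/imsetP/idP => [[g + ->]|stU]; first by rewrite inE.
have [tabU _ _] := is_standardP _ _ stU.
by have [g eqU] := tableau_trans tabT tabU; exists g; rewrite // inE -eqU.
Qed.

(** Induction on the distance of the weight from its upper bound. A descent in a column is undone by
    a transposition, at the cost of a sign. If the columns increase, a descent in a row gives a
    Garnir relation, whose terms are either equal to that of [g] or of larger weight. *)
Lemma young_sym_straighten mu T g : is_partition n mu -> is_tableau mu T ->
  \d g * young_sym F T
    \in <<[seq \d h * young_sym F T | h <- enum (std_perms mu T)]>>%VS.
Proof.
move=> part tabT; set V := <<_>>%VS; set c := young_sym F T.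
have [d] := ubnP (n * n * n * (n * n * n).+1 + n * n * n
                  - tab_weight (tab_act T g)); elim: d g => // d IHd g le_d.
have [stg|nstg] := boolP (g \in std_perms mu T).
  by apply: memv_span; apply: map_f; rewrite mem_enum.
have tabg := tab_act_tableau g tabT; set U := tab_act T g in le_d tabg nstg.
have step s : (tab_weight U < tab_weight (tab_act U s))%N ->
    \d (s * g)%g * c \in V.
  move=> lt_w; apply: IHd; rewrite tab_actM -/U.
  by have := tab_weight_le (tab_act U s); lia.
have [/existsP[k /existsP[l /and3P[lt_kl /eqP eq_c lt_r]]]|no_col] := boolP
    [exists k : 'I_n, exists l : 'I_n, [&& (k < l)%N, (cell U k).2 == (cell U l).2
                           & ((cell U l).1 < (cell U k).1)%N]].
  have := step _ (tab_weight_swap lt_kl eq_c lt_r).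
  rewrite young_sym_act_col; last exact: col_stab_tperm.
  by rewrite psign_tperm ?neq_ltn ?lt_kl // scaleN1r memvN.
have col_mono k l : (cell U k).2 = (cell U l).2 ->
    ((cell U k).1 <= (cell U l).1)%N -> (k <= l)%N.
  move=> eq_c le_r; rewrite leqNgt; apply/negP => lt_lk.
  case/negP: no_col; apply/existsP; exists l; apply/existsP; exists k.
  rewrite lt_lk eq_c eqxx ltn_neqAle le_r !andbT; apply/eqP => /val_inj eq_r.
  suff kl : k = l by rewrite kl ltnn in lt_lk.
  apply: (tableau_inj tabg); move: eq_c eq_r.
  by case: (cell U k) (cell U l) => [i j] [i' j'] /= -> ->.
have [/existsP[k /existsP[l /and3P[le_lk /eqP eq_r lt_c]]]|no_row] := boolP
    [exists k : 'I_n, exists l : 'I_n, [&& (l <= k)%N, (cell U k).1 == (cell U l).1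
                           & ((cell U k).2 < (cell U l).2)%N]]; last first.
  case/negP: nstg; rewrite inE; apply/is_standardP; split=> // k l.
    move=> eq_r lt_c; rewrite ltnNge; apply: contra no_row => le_lk.
    by apply/existsP; exists k; apply/existsP; exists l; rewrite le_lk eq_r eqxx.
  move=> eq_c lt_r; rewrite ltn_neqAle (col_mono _ _ eq_c (ltnW lt_r)) andbT.
  by apply/eqP=> /val_inj kl; rewrite kl ltnn in lt_r.
have := garnir_relation part tabg eq_r lt_c; cbv zeta.
set X := [set m | _]; set Y := [set m | _]; set G := Sym _.
have X_ge m : m \in X -> (k <= m)%N.
  by rewrite inE => /andP[/eqP eq_c le_r]; apply: col_mono.
have Y_lt m : m \in Y -> (m < k)%N.
  rewrite inE => /andP[/eqP eq_c le_r].
  apply: leq_ltn_trans (col_mono _ _ eq_c le_r) _.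
  rewrite ltn_neqAle le_lk andbT; apply/eqP=> /val_inj lk.
  by rewrite lk ltnn in lt_c.
have colX m : m \in X -> (cell U m).2 = (cell U k).2.
  by rewrite inE => /andP[/eqP].
have colY m : m \in Y -> (cell U m).2 = (cell U l).2.
  by rewrite inE => /andP[/eqP].
(* The entries of [Y], in the right column, lie below [k], and those of [X], in the left column, do
   not; so an exchange moves smaller entries left and larger ones right. *)
have weight_lt s : s \in G -> s \notin col_stab U ->
    (tab_weight U < tab_weight (tab_act U s))%N.
  rewrite inE => sG; apply: (@tab_weight_col_lt _ _ _ k) => m.
    move=> lt_mk; have [mZ|mZ] := boolP (m \in X :|: Y); last by rewrite (out_perm sG).
    have : s m \in X :|: Y by rewrite perm_closed.
    case/setUP: mZ => [/X_ge|mY]; first by rewrite leqNgt lt_mk.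
    by rewrite (colY _ mY) => /setUP[/colX->|/colY->] //; apply: ltnW.
  move=> le_km; have [mZ|mZ] := boolP (m \in X :|: Y); last by rewrite (out_perm sG).
  have : s m \in X :|: Y by rewrite perm_closed.
  case/setUP: mZ => [mX|/Y_lt]; last by rewrite ltnNge le_km.
  by rewrite (colX _ mX) => /setUP[/colX->|/colY->] //; apply: ltnW.
move/(congr1 (fun x => x * \d g)); rewrite mul0r -mulrA young_sym_act -/c.
rewrite mulr_suml (bigID (mem (col_stab U))) /=.
under eq_bigr => s /andP[_ sC].
  rewrite -scalerAl mulrA -ga_deltaM young_sym_act_col // scalerA psign_sq scale1r.
  over.
rewrite sumr_const => /eqP; rewrite addr_eq0 => /eqP eq_V.
have {}eq_V : (\d g * c) *+ #|[pred s in G | s \in col_stab U]| \in V.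
  rewrite eq_V memvN; apply: memv_suml => s /andP[sG sC].
  by rewrite -scalerAl mulrA -ga_deltaM memvZ // step // weight_lt.
(* The multiplicity is the order of a subgroup of the symmetric group, so it divides n!. *)
have card_neq0 : #|[pred s in G | s \in col_stab U]|%:R != 0 :> F.
  have -> : #|[pred s in G | s \in col_stab U]| = #|(G :&: col_stab U)%G|.
    by apply: eq_card => s; rewrite !inE.
  have := cardSg (subsetT (G :&: col_stab U)%G); rewrite cardsT card_Sn.
  case/dvdnP=> q eq_q; apply: contraNneq nfact_neq0 => card0.
  by rewrite eq_q natrM card0 mulr0.
rewrite -scaler_nat in eq_V.
by rewrite -[_ * c](scalerK card_neq0) memvZ.
Qed.

(** For independence, take the least row word among the terms with nonzero coefficient: left
    multiplication by the symmetrizer of its tableau kills all other terms. *)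
Lemma dim_young_left_ideal mu T : is_partition n mu -> is_tableau mu T ->
  \dim <<[seq \d g * young_sym F T | g <- enum 'S_n]>> = num_std n mu.
Proof.
move=> part tabT; set c := young_sym F T; pose G := std_perms mu T.
have [q [q0 cc _]] := young_sym_quasi_idem nfact_neq0 tabT.
pose X := map_tuple (fun h => \d h * c) (enum_tuple G).
have -> : <<[seq \d g * c | g <- enum 'S_n]>>%VS = <<X>>%VS.
  apply/eqP; rewrite eqEsubv; apply/andP; split; apply/span_subvP.
    by move=> _ /mapP[g _ ->]; apply: young_sym_straighten.
  by move=> _ /mapP[g _ ->]; apply: memv_span; apply: map_f; rewrite mem_enum.
suff /eqP -> : free X by rewrite size_tuple card_std_perms.
have X_nth (i : 'I_#|G|) : X`_i = \d (enum_val i) * c.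
  by rewrite -tnth_nth tnth_map /= (tnth_nth 1%g) -enum_val_nth.
have X_mul (i j : 'I_#|G|) : young_sym F (tab_act T (enum_val j)) * X`_i
    = young_sym F (tab_act T (enum_val j)) * young_sym F (tab_act T (enum_val i))
      * \d (enum_val i).
  by rewrite X_nth -mulrA young_sym_act.
apply/freeP=> a sum0 i0; apply/eqP; apply: contraT => a_i0.
pose word (i : 'I_#|G|) := row_word (tab_act T (enum_val i)).
have [j a_j j_min] := Order.TotalTheory.arg_minP (P := fun i => a i != 0) word a_i0.
have std (i : 'I_#|G|) : is_standard mu (tab_act T (enum_val i)).
  by have := enum_valP i; rewrite inE.
move/(congr1 (fun x => young_sym F (tab_act T (enum_val j)) * x)): sum0.
rewrite mulr0 mulr_sumr (bigD1 j) //= big1 => [|i ne_ij].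
  rewrite addr0 -scalerAr X_nth mulrA young_sym_act -mulrA cc.
  move/(congr1 (fun x => \d (enum_val j)^-1%g * x)).
  rewrite mulr0 -!scalerAr mulrA -ga_deltaM mulVg ga_delta1 mul1r => /eqP.
  rewrite scalerA scaler_eq0 mulf_eq0 (negPf a_j) (negPf q0) /= => /eqP c0.
  have := coef_young_sym1 F tabT; rewrite c0 /ga_coef ffunE => /esym/eqP.
  by rewrite oner_eq0.
rewrite -scalerAr; have [->|a_i] := eqVneq (a i) 0; first by rewrite scale0r.
have ne_tab : tab_act T (enum_val j) != tab_act T (enum_val i).
  apply: contra ne_ij => /eqP eq_ji; apply/eqP/enum_val_inj/permP => k.
  by apply: (tableau_inj tabT); rewrite -!cell_act eq_ji.
have [k [l [ne_kl kl_row kl_col]]] :=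
  standard_row_word_le part (std j) (std i) ne_tab (j_min _ a_i).
by rewrite X_mul (young_sym_mul_eq0 nfact_neq0 ne_kl) // mul0r scaler0.
Qed.

Lemma young_sym_sq mu T : is_partition n mu -> is_tableau mu T ->
  (num_std n mu)%:R != 0 :> F /\
  young_sym F T * young_sym F T
    = (n`!%:R / (num_std n mu)%:R) *: young_sym F T.
Proof.
move=> part tabT; have [q [q0 cc]] := young_sym_quasi_idem nfact_neq0 tabT.
rewrite (dim_young_left_ideal part tabT) => eq_nf.
have d0 : (num_std n mu)%:R != 0 :> F.
  by apply: contraNneq nfact_neq0 => d0; rewrite eq_nf d0 mulr0.
by split=> //; rewrite cc eq_nf mulfK.
Qed.

End SpechtBasis.

(** * Diagrams of partitions *)

Section Diagrams.
Variable n : nat.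
Implicit Types (mu : seq nat) (T : filling n).

Lemma size_partition mu : is_partition n mu -> (size mu <= n)%N.
Proof.
case/and3P=> _ + /eqP <-; elim: mu => //= a mu IHmu.
rewrite inE negb_or eq_sym -lt0n => /andP[a_gt0 /IHmu le_mu].
by rewrite -add1n leq_add.
Qed.

Lemma card_diagram_partition mu : is_partition n mu -> #|diagram n mu| = n.
Proof.
move=> part; have /and3P[_ _ /eqP sum_mu] := part.
have le_nth i : (nth 0 mu i <= n)%N.
  have [lt_i|] := ltnP i (size mu); last by move=> ?; rewrite nth_default.
  by rewrite -sum_mu sumnE (big_nth 0%N) big_mkord (bigD1 (Ordinal lt_i)) ?leq_addr.
transitivity (\sum_(i < n) \sum_(j < n | (j < nth 0 mu i)%N) 1)%N.
  rewrite -sum1_card pair_big_dep /=.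
  by apply: eq_bigl => c; rewrite mem_diagram.
under eq_bigr => i _ do
  rewrite -(big_ord_widen n (fun=> 1%N) (le_nth i)) sum_nat_const card_ord muln1.
rewrite -[RHS]sum_mu sumnE (big_nth 0%N) big_mkord.
rewrite (big_ord_widen n (nth 0%N mu) (size_partition part)) [RHS]big_mkcond /=.
by apply: eq_bigr => i _; case: ltnP => // le_i; rewrite nth_default.
Qed.

Lemma ex_tableau mu : is_partition n mu -> exists T, is_tableau mu T.
Proof.
move=> part; have card_mu := card_diagram_partition part.
pose f k := enum_val (cast_ord (esym card_mu) k).
exists [ffun k => f k]; apply: is_tableauP => // [k l|k]; rewrite /cell !ffunE.
  by move/enum_val_inj/cast_ord_inj.
exact: enum_valP.
Qed.

Lemma count_gt_sorted mu i j : sorted geq mu ->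
  (i < count (fun r => j < r)%N mu)%N = (j < nth 0 mu i)%N.
Proof.
elim: mu i => [|a mu IHmu] i; first by rewrite /= nth_nil !ltn0.
have geq_trans : transitive geq by move=> b c d cb bd; apply: leq_trans bd cb.
rewrite [sorted _ _]/= (path_sortedE geq_trans) => /andP[/allP le_a sort_mu].
have [lt_ja|le_aj] := ltnP j a.
  by case: i => [|i] /=; rewrite lt_ja // add1n ltnS IHmu.
have count0 : count (fun r => j < r)%N mu = 0%N.
  apply/eqP; rewrite -leqn0 leqNgt -has_count; apply/hasPn => r /le_a /= le_r.
  by rewrite -leqNgt (leq_trans le_r).
have ja_false : (j < a)%N = false by rewrite ltnNge le_aj.
rewrite /= count0 ja_false ltn0; case: i => [|i] /=; first by rewrite ja_false.
by rewrite -IHmu // count0.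
Qed.

Lemma mem_diagram_conj mu (i j : 'I_n) : is_partition n mu ->
  ((j, i) \in diagram n (conj_partition mu)) = ((i, j) \in diagram n mu).
Proof.
move=> part; have /and3P[sort_mu _ _] := part.
rewrite !mem_diagram /= /conj_partition; have [lt_j|le_j] := ltnP j (head 0%N mu).
  by rewrite nth_mkseq // count_gt_sorted.
rewrite nth_default ?size_mkseq // ltn0; apply/esym/negbTE; rewrite -leqNgt.
by apply: leq_trans le_j; rewrite -nth0; apply: partition_nth_mono part _.
Qed.

Lemma conj_is_tableau mu T : is_partition n mu ->
  is_tableau (conj_partition mu) (conj_tableau T) = is_tableau mu T.
Proof.
move=> part; rewrite /is_tableau; congr (_ && _).
  apply/injectiveP/injectiveP => injT k l.
    by move=> eq_kl; apply: injT; rewrite !ffunE /cell eq_kl.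
  rewrite !ffunE => -[eq2 eq1]; apply: injT; rewrite /cell in eq1 eq2.
  by rewrite (surjective_pairing (T k)) eq1 eq2 -surjective_pairing.
pose swap (c : 'I_n * 'I_n) := (c.2, c.1).
have swapK : involutive swap by case.
have -> : cell (conj_tableau T) @: [set: 'I_n] = swap @: (cell T @: [set: 'I_n]).
  by rewrite -imset_comp; apply: eq_imset => k; rewrite cell_conj.
have -> : diagram n (conj_partition mu) = swap @: diagram n mu.
  apply/setP=> c; rewrite -[c]swapK (mem_imset _ _ (inv_inj swapK)).
  by case: (swap c) => i j; rewrite mem_diagram_conj.
by rewrite (inj_eq (imset_inj (inv_inj swapK))).
Qed.

Lemma conj_is_standard mu T : is_partition n mu ->
  is_standard (conj_partition mu) (conj_tableau T) = is_standard mu T.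
Proof.
move=> part; rewrite /is_standard conj_is_tableau //; congr (_ && _).
by rewrite andbC; congr (_ && _); apply: eq_forallb => k; apply: eq_forallb => l;
   rewrite !cell_conj.
Qed.

Lemma num_std_conj mu :
  is_partition n mu -> num_std n (conj_partition mu) = num_std n mu.
Proof.
move=> part; rewrite /num_std -(card_imset _ (inv_inj (@conj_tableauK n))).
apply: eq_card => T; rewrite -[T]conj_tableauK.
rewrite (mem_imset _ _ (inv_inj (@conj_tableauK n))) !inE.
by rewrite conj_tableauK conj_is_standard.
Qed.

End Diagrams.

(** * Central idempotents *)

(** Multiplied from the left, [e i] passes the factors of smaller index unchanged and is killed by
    its own; from the right it passes those of larger index. *)
Lemma triangular_idem_prod (R : nzRingType) d (e : 'I_d -> R) :
    (forall i, e i * e i = e i) ->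
    (forall i j : 'I_d, (j < i)%N -> e i * e j = 0) ->
  forall i, e i * \prod_(j < d) (1 - e j) = 0
         /\ \prod_(j < d) (1 - e j) * e i = 0.
Proof.
elim: d e => [|d IHd] e ee e0; first by case.
pose e' i := e (lift ord0 i).
have {}IHd := IHd e' (fun i => ee _) (fun i j ij => e0 _ _ (ij : lift ord0 j < lift ord0 i)%N).
have e_ord0 : \prod_(j < d) (1 - e' j) * e ord0 = e ord0.
  elim/big_rec: _ => [|j x _ IHx]; first by rewrite mul1r.
  by rewrite -mulrA IHx mulrBl mul1r e0 // subr0.
move=> i; rewrite big_ord_recl; case: (unliftP ord0 i) => [j ->|->].
  have [l r] := IHd j; split; last by rewrite -mulrA r mulr0.
  by rewrite mulrA mulrBr mulr1 e0 // subr0.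
split; first by rewrite mulrA mulrBr mulr1 ee subrr mul0r.
by rewrite -mulrA e_ord0 mulrBl mul1r ee subrr.
Qed.

Section Wedderburn.
Variables (F : finFieldType) (n : nat).
Hypothesis nfact_neq0 : n`!%:R != 0 :> F.
Notation A := (group_algebra F 'S_n).
Notation "\d g" := (ga_delta F g) (at level 8, g at level 2).
Implicit Types (mu : seq nat) (T U : filling n) (g h s r : 'S_n) (x y e f : A).

Lemma wedderburn_two_sided mu : two_sided_ideal (@wedderburn_ideal F n mu).
Proof.
split=> [J [] //|x y Jx Jy J idJ genJ|a x b Jx J idJ genJ].
  by have [_ JD _] := idJ; apply: JD; [apply: Jx | apply: Jy].
by have [_ _ JM] := idJ; apply: JM; apply: Jx.
Qed.

Lemma wedderburn_young mu T :
  is_tableau mu T -> wedderburn_ideal mu (young_idem F mu T).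
Proof. by move=> tabT J idJ genJ; apply: genJ. Qed.

Lemma wedderburnM mu x y a : wedderburn_ideal mu y -> wedderburn_ideal mu (x * y * a).
Proof. by have [_ _] := wedderburn_two_sided mu; apply. Qed.

Lemma wedderburnMl mu x y : wedderburn_ideal mu y -> wedderburn_ideal mu (x * y).
Proof. by rewrite -[x * y]mulr1; apply: wedderburnM. Qed.

(* With c = b a and c^2 = k c one has a c b = (a b)^2 = k a b.                *)
Lemma wedderburn_young_bar mu T :
  is_tableau mu T -> wedderburn_ideal mu (young_idem_bar F mu T).
Proof.
move=> tabT; have [k [k0 cc _]] := young_sym_quasi_idem nfact_neq0 tabT.
have -> : young_idem_bar F mu T
    = (k^-1 *: row_sum F T) * young_idem F mu T * col_sum F T.
  rewrite young_idem_barE young_idemE -scalerAl -scalerAr -!scalerAl.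
  have := congr1 (@ga_star _ _) cc.
  rewrite ga_starM ga_starZ star_young_sym /young_sym !mulrA => ->.
  by rewrite !scalerA mulrAC mulVf // mul1r.
by apply: wedderburnM; apply: wedderburn_young.
Qed.

Lemma wedderburn_star mu x : wedderburn_ideal mu x -> wedderburn_ideal mu (ga_star x).
Proof.
move=> Jx; apply: (Jx (fun x => wedderburn_ideal mu (ga_star x))) => [|T tabT].
  split=> [|y z Jy Jz|a y b Jy].
  - by rewrite ga_star0; have [] := wedderburn_two_sided mu.
  - by rewrite ga_starD; have [_ JD _] := wedderburn_two_sided mu; apply: JD.
  by rewrite !ga_starM mulrA; apply: wedderburnM.
rewrite young_idemE ga_starZ star_young_sym -young_idem_barE.
exact: wedderburn_young_bar.
Qed.

Lemma central_idem_of_unique mu e f :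
  is_central_idem_of mu e -> is_central_idem_of mu f -> e = f.
Proof.
move=> [[[ee ce] _ _] Je] [[[ff cf] _ _] Jf].
have [a eq_e] : exists a, e = a * f by apply/Jf/Je; exists 1; rewrite mul1r.
have [b eq_f] : exists b, f = b * e by apply/Je/Jf; exists 1; rewrite mul1r.
have ef : e * f = e by rewrite eq_e -mulrA ff.
by rewrite -ef cf {1}eq_f -mulrA ee -eq_f.
Qed.

(** Symmetrizers of one shape are conjugate, and the annihilator of a central element is a two-sided
    ideal. *)
Lemma central_annihilates_wedderburn mu T e : is_tableau mu T ->
    (forall a, a * e = e * a) -> e * young_sym F T = 0 ->
  forall x, wedderburn_ideal mu x -> e * x = 0.
Proof.
move=> tabT ce eT x Jx; apply: (Jx (fun x => e * x = 0)) => [|U tabU].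
  split=> [|y z ey ez|a y b ey]; first by rewrite mulr0.
    by rewrite mulrDr ey ez addr0.
  by rewrite !mulrA -ce -[a * e * y]mulrA ey mulr0 mul0r.
have [g ->] := tableau_trans tabT tabU.
have -> : young_idem F mu (tab_act T g) = ((num_std n mu)%:R / n`!%:R)
    *: (\d g * young_sym F T * \d g^-1%g).
  by rewrite young_idemE -young_sym_act -mulrA -ga_deltaM mulgV mulr1.
by rewrite -scalerAr 2!(mulrA e) -ce -(mulrA _ e) eT mulr0 mul0r scaler0.
Qed.

Section CentralIdempotent.
Variables (lambda : seq nat) (T : 'I_(num_std n lambda) -> filling n).
Hypothesis part : is_partition n lambda.
Hypothesis T_std : forall i, is_standard lambda (T i).
Hypothesis T_onto : forall U, is_standard lambda U -> exists i, U = T i.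
Hypothesis orth : forall i j : 'I_(num_std n lambda), (j < i)%N ->
  young_idem F lambda (T i) * young_idem F lambda (T j) = 0.

Let e i := young_idem F lambda (T i).
Let f := 1 - \prod_(i < num_std n lambda) (1 - e i).
Let J := @wedderburn_ideal F n lambda.

Let T_tab i : is_tableau lambda (T i).
Proof. by have [] := is_standardP _ _ (T_std i). Qed.

Let num_std_neq0 : (num_std n lambda)%:R != 0 :> F.
Proof.
have [U tabU] := ex_tableau part.
by have [] := young_sym_sq nfact_neq0 part tabU.
Qed.

Let ee i : e i * e i = e i.
Proof.
rewrite /e !young_idemE -scalerAl -scalerAr.
have [_ ->] := young_sym_sq nfact_neq0 part (T_tab i).
rewrite !scalerA; congr (_ *: _); field.
by rewrite nfact_neq0.
Qed.

Let young_symE i : young_sym F (T i) = (n`!%:R / (num_std n lambda)%:R) *: e i.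
Proof.
by rewrite /e young_idemE scalerA mulf_div [X in X / _]mulrC divff ?scale1r ?mulf_neq0.
Qed.

Let f_fixl i : f * e i = e i.
Proof.
have [_ pe] := triangular_idem_prod ee orth i.
by rewrite /f mulrBl mul1r pe subr0.
Qed.

Let f_left_id x : J x -> f * x = x.
Proof.
(* Quantifying over [a] makes the property stable under left multiplication, as a two-sided ideal
   requires. *)
move=> Jx; suff : forall a, f * (a * x) = a * x.
  by move/(_ 1); rewrite mul1r.
apply: (Jx (fun x => forall a, f * (a * x) = a * x)) => [|U tabU a].
  split=> [a|y z fy fz a|b y c fy a]; first by rewrite !mulr0.
    by rewrite !mulrDr fy fz.
  by rewrite !mulrA -[f * a * b]mulrA -[f * _ * y]mulrA fy.
rewrite young_idemE -!scalerAr; congr (_ *: _).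
rewrite (ga_sum_delta a) mulr_suml mulr_sumr; apply: eq_bigr => g _.
rewrite -scalerAl -scalerAr; congr (_ *: _).
have := young_sym_straighten nfact_neq0 g part tabU.
move: (\d g * _); apply: span_ind => [|u v fu fv|k u fu|v].
- by rewrite mulr0.
- by rewrite mulrDr fu fv.
- by rewrite -scalerAr fu.
case/mapP=> h; rewrite mem_enum inE => /T_onto[i eq_i] ->.
by rewrite -young_sym_act eq_i young_symE -scalerAl -scalerAr mulrA f_fixl.
Qed.

Let Jf : J f.
Proof.
have [J0 JD _] := wedderburn_two_sided lambda.
rewrite /f; elim/big_rec: _ => [|i x _ Jx]; first by rewrite subrr.
have -> : 1 - (1 - e i) * x = e i * x + (1 - x).
  by rewrite mulrBl mul1r opprB addrCA addrC.
apply: JD => //; rewrite -[e i]mul1r.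
by apply: wedderburnM; apply: wedderburn_young.
Qed.

Let f_right_star x : J x -> x * ga_star f = x.
Proof.
by move=> /wedderburn_star/f_left_id/(congr1 (@ga_star _ _));
  rewrite ga_starM ga_starK.
Qed.

(** Evaluate f f* with [f] as left identity and with f* as right identity. *)
Let f_star : ga_star f = f.
Proof.
by rewrite -[RHS]f_right_star // f_left_id //; apply: wedderburn_star.
Qed.

Let f_right_id x : J x -> x * f = x.
Proof. by move=> Jx; rewrite -{1}f_star f_right_star. Qed.

(** Both a f and f a lie in the ideal, so each equals f a f. *)
Let f_central : central_idempotent f.
Proof.
split=> [|a]; first exact: f_left_id.
rewrite -[LHS]f_left_id; last exact: wedderburnMl.
rewrite mulrA f_right_id // -[f * a]mul1r mulrA; exact: wedderburnM.
Qed.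

(** For primitivity, the sandwich lemma makes [e1] act on [c] as a scalar [al], which is 0 or 1 by
    idempotence. Accordingly [e1] or [e2] kills [c], hence the whole ideal, which contains [f]. *)
Lemma young_idem_prod_central : is_central_idem_of lambda f.
Proof.
have [d_gt0|] := ltnP 0 (num_std n lambda); last first.
  by rewrite leqn0 => /eqP d0; have := num_std_neq0; rewrite d0 eqxx.
pose U := T (Ordinal d_gt0); pose c := young_sym F U.
have tabU : is_tableau lambda U by apply: T_tab.
have c_neq0 : c != 0.
  apply/eqP=> c0; have := coef_young_sym1 F tabU.
  by rewrite -/c c0 /ga_coef ffunE => /esym/eqP; rewrite oner_eq0.
have fc : f * c = c by rewrite /c young_symE -scalerAr f_fixl.
split; last first.
  move=> x; split=> [Jx|[a ->]]; first by exists x; rewrite f_right_id.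
  exact: wedderburnMl.
split=> // [f0|e1 e2 [ee1 ce1] [ee2 ce2] e12 f12].
  by rewrite -fc f0 mul0r eqxx in c_neq0.
have e21 : e2 * e1 = 0 by rewrite ce1.
have [k [k0 cc _]] := young_sym_quasi_idem nfact_neq0 tabU.
have [q cec] := young_sym_sandwich nfact_neq0 e1 tabU.
pose al := q / k; have e1c : e1 * c = al *: c.
  apply: (scalerI k0); rewrite scalerA /al mulrC divfK // -cec ce1 -mulrA.
  by rewrite cc -scalerAr.
have : al * (1 - al) == 0.
  rewrite -[_ == 0]orbF -(negPf c_neq0) -scaler_eq0 mulrBr mulr1 scalerBl subr_eq0.
  by rewrite -[al * al *: c]scalerA -e1c (scalerAr al e1 c) -e1c (mulrA e1 e1) ee1.
rewrite mulf_eq0 subr_eq0.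
case/orP=> /eqP al_eq; [left | right].
  have <- : e1 * f = e1 by rewrite f12 mulrDr ee1 e12 addr0.
  apply: (central_annihilates_wedderburn tabU ce1) Jf.
  by rewrite -/c e1c al_eq scale0r.
have <- : e2 * f = e2 by rewrite f12 mulrDr ee2 e21 add0r.
apply: (central_annihilates_wedderburn tabU ce2) Jf.
apply: (addrI (e1 * c)); rewrite addr0 -mulrDl -f12 -/c fc e1c -al_eq.
by rewrite scale1r.
Qed.

End CentralIdempotent.

(** * The sign automorphism and the conjugate partition *)

Definition ga_twist x : A := [ffun g => psign F g * ga_coef x g].

Lemma ga_coef_twist x g : ga_coef (ga_twist x) g = psign F g * ga_coef x g.
Proof. by rewrite /ga_coef ffunE. Qed.

Lemma ga_twistK : involutive ga_twist.
Proof.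
move=> x; apply: ga_eqP => g.
by rewrite !ga_coef_twist mulrA psign_sq mul1r.
Qed.

Lemma ga_twistD x y : ga_twist (x + y) = ga_twist x + ga_twist y.
Proof.
by apply: ga_eqP => g; rewrite !(ga_coef_twist, ga_coefD) mulrDr.
Qed.

Lemma ga_twistZ (k : F) x : ga_twist (k *: x) = k *: ga_twist x.
Proof. by apply: ga_eqP => g; rewrite !(ga_coef_twist, ga_coefZ) mulrCA. Qed.

Lemma ga_twist0 : ga_twist 0 = 0.
Proof. by rewrite -(scale0r (0 : A)) ga_twistZ !scale0r. Qed.

Lemma ga_twistB x y : ga_twist (x - y) = ga_twist x - ga_twist y.
Proof. by rewrite -scaleN1r ga_twistD ga_twistZ scaleN1r. Qed.

Lemma ga_twistM x y : ga_twist (x * y) = ga_twist x * ga_twist y.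
Proof.
apply: ga_eqP => g; rewrite ga_coef_twist !ga_coefM mulr_sumr.
apply: eq_bigr => h _; rewrite !ga_coef_twist -{1}(mulKVg h g) psignM.
by rewrite mulrACA.
Qed.

Lemma ga_twist1 : ga_twist 1 = 1.
Proof.
apply: ga_eqP => g; rewrite ga_coef_twist -ga_delta1 ga_coef_delta.
by case: eqP => [->|_]; rewrite ?psign1 ?mulr1 ?mulr0.
Qed.

Lemma twist_young_sym U :
  ga_twist (young_sym F U) = row_sum F (conj_tableau U) * col_sum F (conj_tableau U).
Proof.
rewrite ga_twistM; congr (_ * _); apply: ga_eqP => g; rewrite ga_coef_twist.
  by rewrite coef_alt_sum coef_row_sum row_stab_conj mulrA psign_sq mul1r.
by rewrite coef_alt_sum coef_row_sum col_stab_conj.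
Qed.

Lemma twist_young_idem mu U : is_partition n mu ->
  ga_twist (young_idem F mu U)
    = young_idem_bar F (conj_partition mu) (conj_tableau U).
Proof.
move=> part; rewrite young_idemE young_idem_barE ga_twistZ twist_young_sym.
by rewrite num_std_conj.
Qed.

Lemma twist_young_idem_conj mu U : is_partition n mu ->
  ga_twist (young_idem F (conj_partition mu) U)
    = young_idem_bar F mu (conj_tableau U).
Proof.
move=> part; rewrite young_idemE young_idem_barE ga_twistZ twist_young_sym.
by rewrite num_std_conj.
Qed.

Lemma two_sided_ideal_twist (J : A -> Prop) :
  two_sided_ideal J -> two_sided_ideal (fun x => J (ga_twist x)).
Proof.
case=> J0 JD JM; split=> [|x y Jx Jy|a x b Jx]; first by rewrite ga_twist0.
  by rewrite ga_twistD; apply: JD.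
by rewrite !ga_twistM; apply: JM.
Qed.

(** The twist sends generators for one shape to barred idempotents of the other, which lie in the
    ideal of that shape by [wedderburn_young_bar]. *)
Lemma wedderburn_ideal_conj mu x : is_partition n mu ->
  wedderburn_ideal (conj_partition mu) x <-> wedderburn_ideal mu (ga_twist x).
Proof.
move=> part; have part_conj := conj_is_tableau _ part.
split=> Jx.
  apply: (Jx (fun x => wedderburn_ideal mu (ga_twist x))) => [|U tabU].
    exact/two_sided_ideal_twist/wedderburn_two_sided.
  rewrite twist_young_idem_conj //; apply: wedderburn_young_bar.
  by rewrite -part_conj conj_tableauK.
rewrite -[x]ga_twistK.
apply: (Jx (fun x => wedderburn_ideal _ (ga_twist x))) => [|U tabU].
  exact/two_sided_ideal_twist/wedderburn_two_sided.
by rewrite twist_young_idem //; apply: wedderburn_young_bar; rewrite part_conj.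
Qed.

Lemma central_idempotent_twist x :
  central_idempotent x -> central_idempotent (ga_twist x).
Proof.
case=> xx cx; split=> [|a]; first by rewrite -ga_twistM xx.
by rewrite -[a]ga_twistK -!ga_twistM cx.
Qed.

Lemma central_idem_of_twist mu e : is_partition n mu ->
  is_central_idem_of mu e -> is_central_idem_of (conj_partition mu) (ga_twist e).
Proof.
move=> part [[ce e0 prim_e] Je]; split; last first.
  move=> x; rewrite wedderburn_ideal_conj // Je.
  split=> [[a eq_x]|[a ->]]; last by exists (ga_twist a); rewrite ga_twistM ga_twistK.
  by exists (ga_twist a); rewrite -ga_twistM -eq_x ga_twistK.
split; first exact: central_idempotent_twist.
  by move=> te0; apply: e0; rewrite -[e]ga_twistK te0 ga_twist0.
have tw0 x : ga_twist x = 0 -> x = 0.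
  by move=> tx0; rewrite -[x]ga_twistK tx0 ga_twist0.
move=> e1 e2 ce1 ce2 e12 te.
have [||||/tw0|/tw0] := prim_e (ga_twist e1) (ga_twist e2); try by [left | right].
- exact: central_idempotent_twist.
- exact: central_idempotent_twist.
- by rewrite -ga_twistM e12 ga_twist0.
by rewrite -ga_twistD -te ga_twistK.
Qed.

End Wedderburn.

(* The order is only required to satisfy e_{T_i} e_{T_j} = 0 for i > j, not   *)
(* conversely: for i < j this product may vanish too (it does for the two     *)
(* standard tableaux of shape (2,1)), so the converse would not be            *)
(* satisfiable.                                                               *)
Theorem theorem3p1 (F : finFieldType) (p n : nat) (lambda : seq nat)
    (T : 'I_(num_std n lambda) -> filling n) (lt : rel (filling n))
    (charF : p \in [pchar F]) (n_gt0 : (0 < n)%N) (lt_n_p : (n < p)%N)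
    (lambda_part : is_partition n lambda)
    (T_inj : injective T)
    (T_std : [set T i | i in [set: 'I_(num_std n lambda)]]
               = std_tableaux n lambda)
    (lt_irr : irreflexive lt) (lt_trans : transitive lt)
    (lt_index : forall i j : 'I_(num_std n lambda), (j < i)%N <-> lt (T j) (T i))
    (lt_conj : forall i j : 'I_(num_std n lambda),
       lt (T j) (T i) <-> lt (conj_tableau (T i)) (conj_tableau (T j)))
    (orth : forall i j : 'I_(num_std n lambda), lt (T j) (T i) ->
       young_idem F lambda (T i) * young_idem F lambda (T j) = 0 /\
       young_idem_bar F (conj_partition lambda) (conj_tableau (T i))
         * young_idem_bar F (conj_partition lambda) (conj_tableau (T j)) = 0) :
  (forall e : group_algebra F 'S_n, is_central_idem_of lambda e <->
     e = 1 - \prod_(i < num_std n lambda) (1 - young_idem F lambda (T i))) /\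
  (forall e : group_algebra F 'S_n, is_central_idem_of (conj_partition lambda) e <->
     e = 1 - \prod_(i < num_std n lambda)
               (1 - young_idem_bar F (conj_partition lambda) (conj_tableau (T i)))).
Proof.
have nfact_neq0 : n`!%:R != 0 :> F.
  (* The prime p exceeds every factor of n!. *)
  have p_pr := pcharf_prime charF.
  rewrite -(dvdn_pcharf charF) fact_prod Euclid_dvd_prod //.
  rewrite big_has; apply/hasPn => i; rewrite mem_index_iota ltnS => /andP[i_gt0 le_i].
  by rewrite gtnNdvd // (leq_ltn_trans le_i).
have T_std' i : is_standard lambda (T i).
  by have : T i \in std_tableaux n lambda by [rewrite -T_std imset_f]; rewrite inE.
have T_onto U : is_standard lambda U -> exists i, U = T i.
  move=> stU; have : U \in std_tableaux n lambda by rewrite inE.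
  by rewrite -T_std => /imsetP[i _ ->]; exists i.
have central : is_central_idem_of lambda
    (1 - \prod_(i < num_std n lambda) (1 - young_idem F lambda (T i))).
  apply: young_idem_prod_central => // i j lt_ji.
  by have [] := orth i j (proj1 (lt_index i j) lt_ji).
have central_conj : is_central_idem_of (conj_partition lambda)
    (1 - \prod_(i < num_std n lambda)
      (1 - young_idem_bar F (conj_partition lambda) (conj_tableau (T i)))).
  have := central_idem_of_twist nfact_neq0 lambda_part central.
  rewrite ga_twistB ga_twist1 (big_morph _ (@ga_twistM F n) (@ga_twist1 F n)).
  under eq_bigr do rewrite ga_twistB ga_twist1 twist_young_idem //.
  by [].
by split=> e; split=> [/central_idem_of_unique|->] //; apply.
Qed.
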